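(* Let $U'$ be a unital of order $q$ of $\mathcal{NP}$ that contains $(0,1,0)$ or $(1,0,0)$, and suppose $q$ divides $o(\mathrm{Aut}(U')\cap\mathfrak L)$. Then $U'$ is isomorphic to a unital $U$ for which the following hold. (i) $U$ is a parabolic unital of $\mathcal{NP}$ containing $(0,1,0)$. (ii) $H:=\mathrm{Aut}(U)\cap\mathfrak T=\{\phi(1,1,0,w):w\in W\}$, where $W$ is a subspace of $\mathbb{F}_{q^2}$ viewed as an $\mathbb{F}_p$-vector space, with $|W|=q$; moreover the scalar field $\mathbb{F}_{q_0}$ of $W$ (a subfield of $\mathbb{F}_{q^2}$ with $\mathbb{F}_{q_0}W=W$) is a subfield of $\mathbb{F}_q$. (iii) $U\cap[1,0,0]=\{(0,1,0)\}\cup\{(0,w,1):w\in W\}$, and $\{(0,w,1):w\in W\}$ is precisely the set of tangency points of the $q$ affine tangent lines of $U$ through $(1,0,0)$. (iv) The group $G:=\mathrm{Aut}(U)\cap\mathfrak L$ satisfies $G=HG_1$ where $G_1=G\cap\hat{\mathfrak R}_0$; furthermore $q\mid o(G)$ and $o(G)\mid q(q^2-1)$. (v) $H$ is a normal subgroup of $G$. (vi) $o(G_1)=o(G)/q$. (vii) The set $C=\{c:\ \phi(c,d,0,0)\in G_1\text{ for some }d\}$ has cardinality $o(G_1)$ and is a subgroup of $(\mathbb{F}_{q^2}^*,\star)$. (viii) The set $D=\{d:\ \phi(c,d,0,0)\in G_1\text{ for some }c\}$ is a subgroup of $\mathbb{F}_{q_0}^*$; in particular $D\le\mathbb{F}_q^*$.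 (ix) The rule $\delta(c)=d$ whenever $\phi(c,d,0,0)\in G_1$ defines a map $\delta:C\to D$ which is an onto $r$-to-$1$ homomorphism, where $r=o(C)/o(D)$; furthermore $r\mid(q+1)$.
   Context: Let $p$ be an odd prime, $q=p^e$. The regular nearfield $\mathcal N(2,q)$ has underlying set $\mathbb{F}_{q^2}$, field addition, and multiplication $x\star y=xy$ if $y$ is a nonzero square of $\mathbb{F}_{q^2}$, $x\star y=x^qy$ if $y$ is a nonsquare, $x\star0=0$. The plane $\mathcal{NP}$ has points $(x,y,1)$ ($x,y\in\mathbb{F}_{q^2}$; affine points), $(1,y,0)$ ($y\in\mathbb{F}_{q^2}$), $(0,1,0)$; lines $[s,1,t]$, $[1,0,t]$ ($s,t\in\mathbb{F}_{q^2}$), $[0,0,1]$ (line at infinity); $(x,y,z)$ lies on $[s,u,t]$ iff $x\star s+y\star u+z\star t=0$; it is a projective plane of order $q^2$. For $c,d\in\mathbb{F}_{q^2}^*$, $u,v\in\mathbb{F}_{q^2}$, $\phi(c,d,u,v)$ is the collineation acting on affine points by $(x,y,1)\mapsto(x\star c+u,y\star d+v,1)$ and $\gamma(c,d,u,v)$ the one acting by $(x,y,1)\mapsto(y\star c+u,x\star d+v,1)$. $\mathfrak T=\{\phi(1,1,u,v)\}$, $\hat{\mathfrak R}_0=\{\phi(c,d,0,0):c,d\ne0\}$, $\mathfrak L=\{\phi(c,d,u,v)\}\cup\{\gamma(c,d,u,v)\}$ (linear collineations). A unital of order $q$ in $\mathcal{NP}$ is a set of $q^3+1$ points meeting every line in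 $1$ (tangent) or $q+1$ (secant) points; parabolic means $[0,0,1]$ is a tangent. $\mathrm{Aut}(U)$ is the group of collineations of $\mathcal{NP}$ preserving $U$. Two unitals are isomorphic if one is the image of the other under a collineation of $\mathcal{NP}$. *)

(* Defs.v *)
From HB Require Import structures.
From mathcomp Require Import all_boot all_order all_fingroup all_algebra.
Set Implicit Arguments.
Unset Strict Implicit.
Unset Printing Implicit Defensive.
Import GRing.Theory.
Local Open Scope ring_scope.

(* Throughout, F is a finite field with q ^ 2 elements, q a power of an odd
   prime; these hypotheses are only imposed in the theorem. *)

Definition is_square (F : finFieldType) (y : F) : bool := [exists z : F, y == z ^+ 2].

(* Multiplication of the regular nearfield N(2,q). *)
Definition star (F : finFieldType) (q : nat) (x y : F) : F :=
  if y == 0 then 0 else if is_square y then x * y else x ^+ q * y.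

(* The triples (x,y,1), (1,y,0), (0,1,0). *)
Definition is_point (F : finFieldType) (P : F * F * F) : bool :=
  let: (x, y, z) := P in
  (z == 1) || (z == 0) && ((x == 1) || (x == 0) && (y == 1)).

(* The triples [s,1,t], [1,0,t], [0,0,1]. *)
Definition is_line (F : finFieldType) (l : F * F * F) : bool :=
  let: (s, u, t) := l in
  (u == 1) || (u == 0) && ((s == 1) || (s == 0) && (t == 1)).

Definition point (F : finFieldType) : Type := {P : F * F * F | is_point P}.

Definition line (F : finFieldType) : Type := {l : F * F * F | is_line l}.

Fact aff_subproof (F : finFieldType) (x y : F) : is_point (x, y, 1).
Proof. by rewrite /= eqxx. Qed.

Fact slope_subproof (F : finFieldType) (y : F) : is_point (1, y, 0).
Proof. by rewrite /= !eqxx orbT. Qed.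

Fact vert_subproof (F : finFieldType) : is_point (0 : F, 1 : F, 0 : F).
Proof. by rewrite /= !eqxx !orbT. Qed.

Fact vert_line_subproof (F : finFieldType) (t : F) : is_line (1, 0, t).
Proof. by rewrite /= !eqxx orbT. Qed.

Fact inf_line_subproof (F : finFieldType) : is_line (0 : F, 0 : F, 1 : F).
Proof. by rewrite /= !eqxx !orbT. Qed.

(* (x,y,1), (1,y,0), (0,1,0); [1,0,t], [0,0,1] *)
Definition aff (F : finFieldType) (x y : F) : point F := exist (@is_point F) _ (aff_subproof x y).
Definition slope_pt (F : finFieldType) (y : F) : point F := exist (@is_point F) _ (slope_subproof y).
Definition vert_pt (F : finFieldType) : point F := exist (@is_point F) _ (vert_subproof F).
Definition vert_line (F : finFieldType) (t : F) : line F := exist (@is_line F) _ (vert_line_subproof t).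
Definition inf_line (F : finFieldType) : line F := exist (@is_line F) _ (inf_line_subproof F).

Definition incident (F : finFieldType) (q : nat) (P : point F) (l : line F) : bool :=
  let: (x, y, z) := val P in
  let: (s, u, t) := val l in
  star q x s + star q y u + star q z t == 0.

Definition points_on (F : finFieldType) (q : nat) (l : line F) : {set point F} :=
  [set P | incident q P l].

(* The permutations of the points that map every line onto a line. *)
Definition Coll (F : finFieldType) (q : nat) : {group {perm point F}} :=
  'N([set points_on q l | l : line F] | 'P^*)%G.

Definition AutU (F : finFieldType) (q : nat) (U : {set point F}) :
    {group {perm point F}} :=
  'N_(Coll F q)(U | 'P)%G.

(* The collineation acting on the affine points as f. For the maps f used below
   with c and d nonzero it exists and is unique; the default 1 is then not used. *)
Definition coll_extending (F : finFieldType) (q : nat) (f : F -> F -> point F) :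
    {perm point F} :=
  odflt 1%g [pick g in Coll F q | [forall x, forall y, g (aff x y) == f x y]].

Definition phi (F : finFieldType) (q : nat) (c d u v : F) : {perm point F} :=
  coll_extending q (fun x y => aff (star q x c + u) (star q y d + v)).

Definition gamma (F : finFieldType) (q : nat) (c d u v : F) : {perm point F} :=
  coll_extending q (fun x y => aff (star q y c + u) (star q x d + v)).

Definition translations (F : finFieldType) (q : nat) : {set {perm point F}} :=
  [set phi q 1 1 u v | u : F, v : F].

Definition R0hat (F : finFieldType) (q : nat) : {set {perm point F}} :=
  [set phi q c d 0 0 | c in [set~ (0 : F)], d in [set~ (0 : F)]].

Definition linear_colls (F : finFieldType) (q : nat) : {set {perm point F}} :=
  [set g | [exists c : F, exists d : F, exists u : F, exists v : F,
     [&& c != 0, d != 0 & (g == phi q c d u v) || (g == gamma q c d u v)]]].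

Definition tangent (F : finFieldType) (q : nat) (U : {set point F}) (l : line F) : bool :=
  #|points_on q l :&: U| == 1%N.

Definition secant (F : finFieldType) (q : nat) (U : {set point F}) (l : line F) : bool :=
  #|points_on q l :&: U| == q.+1.

Definition unital (F : finFieldType) (q : nat) (U : {set point F}) : Prop :=
  #|U| = (q ^ 3).+1 /\ forall l : line F, tangent q U l || secant q U l.

Definition parabolic (F : finFieldType) (q : nat) (U : {set point F}) : bool :=
  tangent q U (inf_line F).

Definition isomorphic (F : finFieldType) (q : nat) (U V : {set point F}) : Prop :=
  exists2 g, g \in Coll F q & [set g P | P in U] = V.

(* W is a subspace of F over its prime field, on which a : 'F_p acts as a%:R. *)
Definition Fp_subspace (F : finFieldType) (p : nat) (W : {set F}) : Prop :=
  0 \in W /\ forall a : 'F_p, {in W &, forall u v, a%:R * u + v \in W}.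

(* K is the scalar field of W: the largest subfield K of F with KW = W. *)
Definition scalar_field (F : finFieldType) (W K : {set F}) : Prop :=
  [/\ divring_closed K,
      [set k * w | k in K, w in W] = W
    & forall K' : {set F}, divring_closed K' ->
        [set k * w | k in K', w in W] = W -> K' \subset K].

(* The subfield of order q of F. *)
Definition Fq (F : finFieldType) (q : nat) : {set F} := [set x : F | x ^+ q == x].

Definition star_subgroup (F : finFieldType) (q : nat) (C : {set F}) : Prop :=
  [/\ C \subset [set~ 0], 1 \in C, {in C &, forall x y, star q x y \in C}
    & {in C, forall x, exists2 y, y \in C & star q x y = 1 /\ star q y x = 1}].

(* Main.v *)
(* A Sylow p-subgroup of the linear automorphism group of U' consists of
   translations, because the 2(q^2 - 1)-st power of a linear collineation is one.
   A point of U' at infinity has a unique tangent; if it is affine, it is moved by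
   every translation in another direction, so with q translations at hand the line
   at infinity must be the tangent, at (0,1,0) say. Each further point at infinity
   is on q affine tangents, whose points of contact a translation in that direction
   would fix; hence all translations are vertical, there are exactly q of them, and
   they permute regularly the points of contact of each parallel class of tangents.
   Moving one of those of slope 0 to the origin gives the normal form.
   The remaining arithmetic comes from free actions: C and D act freely by right
   nearfield multiplication on the nonzero elements of F and of W, the units of the
   scalar field act freely on W \ 0, and the kernel of delta acts freely on the q + 1
   affine points of a horizontal secant. *)
Require Import Defs.
From HB Require Import structures.
From mathcomp Require Import all_boot all_order all_fingroup all_algebra.
From mathcomp Require Import all_solvable finfield.
Set Implicit Arguments.
Unset Strict Implicit.
Unset Printing Implicit Defensive.
Import GRing.Theory.
Local Open Scope ring_scope.

(** * The nearfield *)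

(** Point stabilizers are trivial, so [S] is a disjoint union of orbits of length [#|A|]. *)
Lemma card_dvd_free_action (T : finType) (A : {group {perm T}}) (S : {set T}) :
  {in A & S, forall (g : {perm T}) x, g x \in S} ->
  {in A & S, forall (g : {perm T}) x, g x = x -> g = 1%g} -> (#|A| %| #|S|)%N.
Proof.
move=> stab free.
have actsA : [acts A, on S | 'P].
  apply/subsetP=> g Ag; rewrite 2!inE in_setT /=; apply/subsetP=> x Sx.
  by rewrite !inE; apply: stab.
have <- := acts_sum_card_orbit actsA.
apply: (big_ind (fun n => #|A| %| n)%N) => // [m n|]; first exact: dvdn_add.
move=> _ /imsetP[x Sx ->]; rewrite card_orbit.
suff -> : ('C_A[x | 'P] = 1)%g by rewrite indexg1.
apply/trivgP/subsetP => g /setIP[Ag /astab1P gx].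
by apply/set1gP; apply: free gx.
Qed.

Section Nearfield.

Variables (p e q : nat) (F : finFieldType).
Hypotheses (p_prime : prime p) (p_odd : odd p) (e_gt0 : (0 < e)%N).
Hypotheses (qE : q = (p ^ e)%N) (cardF : #|F| = (q ^ 2)%N).

Local Notation "x ⋆ y" := (star q x y) (at level 40, left associativity).

Lemma q_gt2 : (2 < q)%N.
Proof.
have p_gt2 : (2 < p)%N by case: p p_prime p_odd => [|[|[|?]]].
by rewrite qE (leq_trans p_gt2) // -{1}(expn1 p) leq_exp2l // ltnW.
Qed.

Lemma q_gt0 : (0 < q)%N. Proof. by apply: leq_trans q_gt2. Qed.

Lemma q_odd : odd q. Proof. by rewrite qE oddX p_odd orbT. Qed.

Lemma pcharF : p \in [pchar F].
Proof. by apply: (@card_finPcharP F p (e * 2)) => //; rewrite cardF qE expnM. Qed.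

Lemma frobD (x y : F) : (x + y) ^+ q = x ^+ q + y ^+ q.
Proof.
rewrite exprDn_pchar // qE pnatX; apply/orP; left.
by rewrite (eq_pnat _ (pcharf_eq pcharF)) pnat_id.
Qed.

Lemma frobK (x : F) : (x ^+ q) ^+ q = x.
Proof. by rewrite -exprM mulnn -cardF expf_card. Qed.

Lemma one_setC0 : (1 : F) \in [set~ 0]. Proof. by rewrite !inE oner_eq0. Qed.

Lemma card_setC0 : #|[set~ (0 : F)]| = (q ^ 2).-1.
Proof. by rewrite cardsC1 cardF. Qed.

Lemma qq_gt0 : (0 < (q ^ 2).-1)%N.
Proof. by rewrite -card_setC0; apply/card_gt0P; exists 1; apply: one_setC0. Qed.

(** The exponent of Euler's criterion in the field of order q^2. *)
Definition half : nat := (q ^ 2).-1./2.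

Lemma halfE : half.*2 = (q ^ 2).-1.
Proof.
rewrite /half -[RHS]odd_double_half -subn1 oddB ?expn_gt0 ?q_gt0 //.
by rewrite oddX q_odd orbT.
Qed.

Lemma expf_card_pred (x : F) : x != 0 -> x ^+ (q ^ 2).-1 = 1.
Proof.
move=> x0; apply: (mulfI x0).
by rewrite -exprS prednK ?expn_gt0 ?q_gt0 // -cardF expf_card mulr1.
Qed.

Lemma half_sign (x : F) : x != 0 -> (x ^+ half == 1) || (x ^+ half == -1).
Proof. by move=> x0; rewrite -sqrf_eq1 -exprM muln2 halfE expf_card_pred. Qed.

Lemma neg1_neq1 : -1 != 1 :> F.
Proof.
apply/eqP=> E; have /eqP : 2%:R = 0 :> F by rewrite mulr2n -{1}E addNr.
rewrite -(dvdn_pcharf pcharF) dvdn_prime2 // => /eqP p2.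
by move: p_odd; rewrite p2.
Qed.

(** Euler's criterion. For the converse write y = g^i with a generator g of the cyclic unit group,
    of order [half.*2]; this order divides i times [half], so i is even. *)
Lemma is_squareE (y : F) : y != 0 -> is_square y = (y ^+ half == 1).
Proof.
move=> y0; apply/existsP/eqP => [[z /eqP yE] | yh].
  rewrite yE -exprM mul2n halfE expf_card_pred //.
  by apply: contraNneq y0; rewrite yE => ->; rewrite expr0n.
have /cyclicP[g gE] := field_unit_group_cyclic [set: {unit F}]%G.
have yU : y \is a GRing.unit by rewrite unitfE.
have /cycleP[i iE] : FinRing.Unit yU \in <[g]>%g by rewrite -gE inE.
have yg : y = val g ^+ i by rewrite -FinRing.val_unitX -iE.
have og : #[g]%g = half.*2 by rewrite orderE -gE card_finField_unit cardF halfE.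
have : (#[g]%g %| i * half)%N.
  by rewrite order_dvdn; apply/eqP/val_inj; rewrite FinRing.val_unitX /= exprM -yg.
have half_gt0 : (0 < half)%N.
  by rewrite -double_gt0 halfE qq_gt0.
rewrite og -mul2n dvdn_pmul2r // => /dvdnP[j jE].
by exists (val g ^+ j); rewrite yg jE exprM.
Qed.

Lemma is_squareM (y z : F) : y != 0 -> z != 0 ->
  is_square (y * z) = (is_square y == is_square z).
Proof.
move=> y0 z0; rewrite !is_squareE ?mulf_neq0 // exprMn.
have N := negPf neg1_neq1.
case/orP: (half_sign y0) => /eqP->; case/orP: (half_sign z0) => /eqP->;
  by rewrite ?mul1r ?mulrNN ?mulr1 ?eqxx ?N.
Qed.

Lemma is_squareX_q (y : F) : y != 0 -> is_square (y ^+ q) = is_square y.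
Proof.
move=> y0; rewrite !is_squareE ?expf_neq0 // exprAC.
case/orP: (half_sign y0) => /eqP->; first by rewrite expr1n.
by rewrite -signr_odd q_odd expr1.
Qed.

Lemma is_square1 : is_square (1 : F).
Proof. by apply/existsP; exists 1; rewrite expr1n. Qed.

(** Since q is odd, 4 divides (q - 1)(q + 1), so [half] is even. This is what lets signs pass
    through the right factor of [star]. *)
Lemma is_squareN1 : is_square (-1 : F).
Proof.
rewrite is_squareE ?oppr_eq0 ?oner_eq0 // -signr_odd.
suff -> : odd half = false by [].
have : (4 %| half.*2)%N.
  rewrite halfE -subn1 -[1%N]/(1 ^ 2)%N subn_sqr.
  have -> : q = q./2.*2.+1 by rewrite -[LHS]odd_double_half q_odd.
  by rewrite subn1 addn1 -pred_Sn -doubleS -!muln2 mulnACA dvdn_mull.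
by rewrite -muln2 -[4%N]/(2 * 2)%N dvdn_pmul2r // dvdn2 => /negPf.
Qed.

Lemma star0r (x : F) : x ⋆ 0 = 0. Proof. by rewrite /star eqxx. Qed.

Lemma star0l (x : F) : 0 ⋆ x = 0.
Proof.
by rewrite /star expr0n -[q]prednK ?q_gt0 //= mul0r; case: ifP => //; case: ifP.
Qed.

Lemma star1r (x : F) : x ⋆ 1 = x.
Proof. by rewrite /star oner_eq0 is_square1 mulr1. Qed.

Lemma star1l (x : F) : 1 ⋆ x = x.
Proof. by rewrite /star expr1n mul1r; case: eqP => [->//|_]; case: ifP. Qed.

Lemma starDl (x y z : F) : (x + y) ⋆ z = x ⋆ z + y ⋆ z.
Proof.
rewrite /star; case: ifP => _; first by rewrite addr0.
by case: ifP => _; rewrite ?frobD mulrDl.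
Qed.

Lemma starNr (x y : F) : x ⋆ (- y) = - (x ⋆ y).
Proof.
rewrite /star oppr_eq0; case: eqP => [_|/eqP y0]; first by rewrite oppr0.
rewrite -mulN1r is_squareM ?oppr_eq0 ?oner_eq0 // is_squareN1 mulN1r.
by case: (is_square y); rewrite /= mulrN.
Qed.

Lemma starNl (x y : F) : (- x) ⋆ y = - (x ⋆ y).
Proof. by apply/eqP; rewrite -addr_eq0 -starDl addNr star0l. Qed.

Lemma starBl (x y z : F) : (x - y) ⋆ z = x ⋆ z - y ⋆ z.
Proof. by rewrite starDl starNl. Qed.

Lemma star_eq0 (x y : F) : (x ⋆ y == 0) = (x == 0) || (y == 0).
Proof.
rewrite /star; case: (eqVneq y 0) => [_|y0]; first by rewrite eqxx orbT.
by case: ifP => _; rewrite mulf_eq0 (negPf y0) ?expf_eq0 ?q_gt0.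
Qed.

Lemma star_neq0 (x y : F) : x != 0 -> y != 0 -> x ⋆ y != 0.
Proof. by rewrite star_eq0 => /negPf-> /negPf->. Qed.

(** Each nonsquare right factor applies the q-th power once. Being a square is multiplicative and
    invariant under this power, and the power is an involution, so two nonsquare factors cancel. *)
Lemma starA (x y z : F) : x ⋆ (y ⋆ z) = x ⋆ y ⋆ z.
Proof.
case: (eqVneq z 0) => [->|z0]; first by rewrite !star0r.
case: (eqVneq y 0) => [->|y0]; first by rewrite star0l !star0r star0l.
have := star_neq0 y0 z0; rewrite /star (negPf z0) (negPf y0) => /negPf->.
case: (boolP (is_square z)) => sz.
  by rewrite is_squareM // sz; case: is_square; rewrite /= mulrA.
rewrite is_squareM ?expf_neq0 // is_squareX_q // (negPf sz).
by case: is_square; rewrite /= ?exprMn ?frobK mulrA.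
Qed.

Lemma star_Nsq (x y : F) : y != 0 -> ~~ is_square y -> x ⋆ y = x ^+ q * y.
Proof. by rewrite /star => /negPf-> /negPf->. Qed.

Lemma star_sq (x y : F) : is_square y -> x ⋆ y = x * y.
Proof. by rewrite /star => ->; case: eqP => // ->; rewrite mulr0. Qed.

(** The inverse for [star]: for a nonsquare y the q-th power taken here is undone by the one that
    [star] applies to its left factor. *)
Definition sinv (y : F) : F := if is_square y then y^-1 else y^-1 ^+ q.

Lemma sinv_neq0 (y : F) : y != 0 -> sinv y != 0.
Proof. by move=> y0; rewrite /sinv; case: ifP; rewrite ?expf_neq0 ?invr_neq0. Qed.

Lemma starVl (y : F) : y != 0 -> sinv y ⋆ y = 1.
Proof.
move=> y0; rewrite /star (negPf y0) /sinv.
by case: (is_square y); rewrite ?frobK mulVf.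
Qed.

Lemma starVr (y : F) : y != 0 -> y ⋆ sinv y = 1.
Proof.
move=> y0; have v0 := sinv_neq0 y0.
by rewrite -[LHS]star1l -(starVl v0) -starA (starA (sinv y)) starVl // star1l.
Qed.

Lemma starKr (x y : F) : y != 0 -> x ⋆ y ⋆ sinv y = x.
Proof. by move=> y0; rewrite -starA starVr // star1r. Qed.

Lemma starVKr (x y : F) : y != 0 -> x ⋆ sinv y ⋆ y = x.
Proof. by move=> y0; rewrite -starA starVl // star1r. Qed.

Lemma starIr (y : F) : y != 0 -> injective (fun x => x ⋆ y).
Proof. by move=> y0 x x' /(congr1 (fun t => t ⋆ sinv y)); rewrite !starKr. Qed.

Lemma starIl (x : F) : x != 0 -> injective (fun y => x ⋆ y).
Proof.
by move=> x0 y y' /(congr1 (fun t => sinv x ⋆ t)); rewrite !starA starVl // !star1l.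
Qed.

Lemma star_fix (x d : F) : x != 0 -> x ⋆ d = x -> d = 1.
Proof. by move=> x0 /esym; rewrite -{1}[x]star1r => /(starIl x0). Qed.

(** * Right multiplications of the nearfield and their free actions *)

Fact rmul_subproof (c : F) : injective (fun x => if c == 0 then x else x ⋆ c).
Proof. by case: eqVneq => [_ x x'|c0] //; apply: starIr. Qed.

(** Letting 0 act as the identity makes this a permutation for every c, so that sets closed under
    [star] become permutation groups. *)
Definition rmul (c : F) : {perm F} := perm (@rmul_subproof c).

Lemma rmulE (c x : F) : c != 0 -> rmul c x = x ⋆ c.
Proof. by move=> /negPf c0; rewrite permE c0. Qed.

Lemma rmulM (c d : F) : c != 0 -> d != 0 -> (rmul c * rmul d)%g = rmul (c ⋆ d).
Proof.
move=> c0 d0; apply/permP => x; rewrite permM !rmulE ?starA //; exact: star_neq0.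
Qed.

Lemma rmul1 : rmul 1 = 1%g.
Proof. by apply/permP => x; rewrite rmulE ?oner_eq0 // star1r perm1. Qed.

Lemma rmul_inj : {in [set~ 0] &, injective rmul}.
Proof.
move=> c d; rewrite !inE => c0 d0 /permP/(_ 1).
by rewrite !rmulE // !star1l.
Qed.

Section StarClosed.

Variable X : {set F}.
Hypotheses (X0 : X \subset [set~ 0]) (X1 : 1 \in X).
Hypothesis XM : {in X &, forall x y, x ⋆ y \in X}.

Lemma neq0_closed (x : F) : x \in X -> x != 0.
Proof. by move/(subsetP X0); rewrite !inE. Qed.

Lemma rmul_group_set : group_set (rmul @: X).
Proof.
apply/group_setP; split; first by apply/imsetP; exists 1; rewrite ?rmul1.
move=> _ _ /imsetP[c Xc ->] /imsetP[d Xd ->].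
by rewrite rmulM ?neq0_closed //; apply/imset_f/XM.
Qed.

Lemma card_rmul : #|rmul @: X| = #|X|.
Proof.
by apply: card_in_imset => c d Xc Xd; apply: rmul_inj; rewrite !inE ?neq0_closed.
Qed.

Lemma rmulX_card (c : F) : c \in X -> (rmul c ^+ #|X|)%g = 1%g.
Proof.
move=> Xc; rewrite -card_rmul; apply: (@expg_cardG _ (group rmul_group_set)).
exact: imset_f.
Qed.

(** By left cancellation a right multiplication that fixes a nonzero element is the identity, so the
    action is free. *)
Lemma card_dvd_star_free (S : {set F}) : S \subset [set~ 0] ->
  {in S & X, forall s x, s ⋆ x \in S} -> (#|X| %| #|S|)%N.
Proof.
move=> S0 SX; rewrite -card_rmul; apply: (@card_dvd_free_action _ (group rmul_group_set)).
  by move=> _ s /imsetP[c Xc ->] Ss; rewrite rmulE ?neq0_closed //; apply: SX.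
move=> _ s /imsetP[c Xc ->] /(subsetP S0); rewrite !inE => s0.
by rewrite rmulE ?neq0_closed // => /(star_fix s0) ->; rewrite rmul1.
Qed.

End StarClosed.

Lemma star_closed_setC0 : {in [set~ 0] &, forall x y : F, x ⋆ y \in [set~ 0]}.
Proof. by move=> x y; rewrite !inE; apply: star_neq0. Qed.

Lemma rmulX_q2 (c : F) : c != 0 -> (rmul c ^+ (q ^ 2).-1)%g = 1%g.
Proof.
move=> c0; rewrite -card_setC0.
by apply: rmulX_card => //; rewrite ?one_setC0 ?inE //; apply: star_closed_setC0.
Qed.

(** Powers of a square are squares, so nearfield powers and field powers of c agree. *)
Lemma rmulX (c : F) n : c != 0 -> is_square c -> (rmul c ^+ n)%g = rmul (c ^+ n).
Proof.
move=> c0 sc; apply/permP => x; rewrite rmulE ?expf_neq0 // star_sq; last first.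
  rewrite is_squareE ?expf_neq0 // exprAC.
  by move: sc; rewrite is_squareE // => /eqP->; rewrite expr1n.
elim: n => [|n IH]; first by rewrite perm1 mulr1.
by rewrite expgSr permM IH rmulE // star_sq // exprSr mulrA.
Qed.

(* d ⋆ d = d ^ (q + 1) for a nonsquare d, so the (q - 1)-st ⋆-power of d is
   d ^ ((q ^ 2 - 1) / 2) = -1. *)
Lemma is_square_rmulX (d : F) : d != 0 -> (rmul d ^+ q.-1)%g = 1%g -> is_square d.
Proof.
move=> d0 dE; apply: contraT => nsd.
have ddE : d ⋆ d = d ^+ q.+1 by rewrite star_Nsq // exprSr.
have dd0 : d ^+ q.+1 != 0 by rewrite expf_neq0.
have qE2 : q.-1 = (2 * q.-1./2)%N.
  rewrite mul2n -[LHS]odd_double_half -subn1 oddB ?q_gt0 //.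
  by rewrite q_odd.
have sdd : is_square (d ^+ q.+1) by rewrite exprSr is_squareM ?expf_neq0 // is_squareX_q.
have : (rmul d ^+ q.-1)%g = rmul ((d ^+ q.+1) ^+ q.-1./2).
  by rewrite {1}qE2 expgM expgS expg1 rmulM // ddE rmulX.
rewrite dE => /permP/(_ 1); rewrite perm1 rmulE ?expf_neq0 // star1l => /esym E.
case/negP: nsd; rewrite is_squareE //; apply/eqP; rewrite -E -exprM; congr (_ ^+ _).
apply: double_inj; rewrite halfE -!muln2 -mulnA [(_./2 * 2)%N]mulnC -qE2.
by rewrite -subn1 -[1%N]/(1 ^ 2)%N subn_sqr subn1 addn1 mulnC.
Qed.

(** * Collineations *)

(* Affine points are [aff x y]; the points at infinity and the parallel classes
   of affine lines are both indexed by a slope, [None] for the vertical one.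
   The affine lines of slope [o] are the level sets of [pidx o]. *)
Definition pdir (o : option F) : point F :=
  if o is Some m then slope_pt m else vert_pt F.

Fact slope_line_subproof (m t : F) : is_line (- m, 1, - t).
Proof. by rewrite /= eqxx. Qed.

Definition pline (o : option F) (t : F) : line F :=
  if o is Some m then exist (@is_line F) _ (slope_line_subproof m t)
  else vert_line (- t).

Definition pidx (o : option F) (x y : F) : F :=
  if o is Some m then y - x ⋆ m else x.

Variant point_spec : point F -> Type :=
  | PointAff x y : point_spec (aff x y)
  | PointDir o : point_spec (pdir o).

Lemma pointP (P : point F) : point_spec P.
Proof.
have := valP P; case E: (val P) => [[x y] z] /=.
case: (eqVneq z 1) => [z1 _|_] /=.
  suff -> : P = aff x y by left.
  by apply: val_inj; rewrite E z1.
case: (eqVneq z 0) => [z0|_] //=; case: (eqVneq x 1) => [x1 _|_] /=.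
  suff -> : P = pdir (Some y) by right.
  by apply: val_inj; rewrite E z0 x1.
case: (eqVneq x 0) => [x0|_] //= /eqP y1.
suff -> : P = pdir None by right.
by apply: val_inj; rewrite E z0 x0 y1.
Qed.

Variant line_spec : line F -> Type :=
  | LineAff o t : line_spec (pline o t)
  | LineInf : line_spec (inf_line F).

Lemma lineP (l : line F) : line_spec l.
Proof.
have := valP l; case E: (val l) => [[s u] t] /=.
case: (eqVneq u 1) => [u1 _|_] /=.
  suff -> : l = pline (Some (- s)) (- t) by left.
  by apply: val_inj; rewrite E /= !opprK u1.
case: (eqVneq u 0) => [u0|_] //=; case: (eqVneq s 1) => [s1 _|_] /=.
  suff -> : l = pline None (- t) by left.
  by apply: val_inj; rewrite E /= opprK u0 s1.
case: (eqVneq s 0) => [s0|_] //= /eqP t1.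
suff -> : l = inf_line F by right.
by apply: val_inj; rewrite E u0 s0 t1.
Qed.

Lemma aff_inj (x y x' y' : F) : aff x y = aff x' y' -> x = x' /\ y = y'.
Proof. by move/(congr1 val) => -[-> ->]. Qed.

Lemma pdir_inj : injective pdir.
Proof.
move=> [m|] [m'|] // /(congr1 val) /= [].
- by move=> ->.
- by move/eqP; rewrite oner_eq0.
- by move/esym/eqP; rewrite oner_eq0.
Qed.

Lemma aff_neq_dir (x y : F) o : aff x y <> pdir o.
Proof. by case: o => [m|] /(congr1 val) /= [] => [_ _|_ _] /eqP; rewrite oner_eq0. Qed.

Lemma incident_aff (x y t : F) o :
  incident q (aff x y) (pline o t) = (pidx o x y == t).
Proof.
case: o => [m|] /=; rewrite /incident /= !star1r !star1l.
  by rewrite starNr (addrC (- _)) subr_eq0.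
by rewrite star0r addr0 subr_eq0.
Qed.

Lemma incident_dir (t : F) o o' :
  incident q (pdir o') (pline o t) = (o' == o).
Proof.
case: o o' => [m|] [m'|] /=; rewrite /incident /= !star0l ?star1r ?star1l ?star0r ?addr0.
- by rewrite addrC subr_eq0 (inj_eq (@Some_inj _)).
- by rewrite add0r oner_eq0.
- by rewrite oner_eq0.
- by rewrite !eqxx.
Qed.

Lemma incident_aff_inf (x y : F) : incident q (aff x y) (inf_line F) = false.
Proof. by rewrite /incident /= !star0r star1r !add0r oner_eq0. Qed.

Lemma incident_dir_inf o : incident q (pdir o) (inf_line F).
Proof. by case: o => [m|]; rewrite /incident /= !star0r star0l !addr0. Qed.

Lemma pline_neq_inf o (t : F) : pline o t != inf_line F.
Proof.
apply/eqP => E; case: o E => [m|] E.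
  by have := incident_aff_inf 0 t; rewrite -E incident_aff /= star0l subr0 eqxx.
by have := incident_aff_inf t 0; rewrite -E incident_aff /= eqxx.
Qed.

Lemma pline_inj o (t t' : F) : pline o t = pline o t' -> t = t'.
Proof.
case: o => [m|] E; [have := incident_aff 0 t t (Some m)|have := incident_aff t 0 t None].
  by rewrite E incident_aff /= star0l subr0 eqxx => /eqP.
by rewrite E incident_aff /= eqxx => /eqP.
Qed.

Lemma pidxD o (x y u v : F) : pidx o (x + u) (y + v) = pidx o x y + pidx o u v.
Proof. by case: o => [m|] //=; rewrite starDl opprD addrACA. Qed.

Lemma CollP (g : {perm point F}) :
  reflect (forall l, exists l', forall P, incident q (g P) l' = incident q P l)
          (g \in Coll F q).
Proof.
rewrite /= !inE /=; apply: (iffP subsetP) => [gS l | gS _ /imsetP[l _ ->]].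
  have /gS : points_on q l \in [set points_on q l | l : line F] by apply: imset_f.
  rewrite !inE => /imsetP[l' _ E]; exists l' => P.
  have := congr1 (fun S : {set point F} => g P \in S) E.
  by rewrite [in RHS]inE => <-; rewrite /setact mem_imset ?inE //; apply: perm_inj.
rewrite !inE; have [l' E] := gS l.
apply/imsetP; exists l' => //; apply/setP => P.
rewrite inE -[P](permKV g) E /setact mem_imset ?inE //; exact: perm_inj.
Qed.

(** An affine line goes to a line with the same affine points, hence of the same slope, so the
    points at infinity are fixed as well. *)
Lemma Coll_fix_aff (k : {perm point F}) : k \in Coll F q ->
  (forall x y, k (aff x y) = aff x y) -> k = 1%g.
Proof.
move/CollP => kL kA; apply/permP => P; rewrite perm1.
case: (pointP P) => [x y | o]; first exact: kA.
have [l' kl] := kL (pline o 0).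
have inl (x y : F) : incident q (aff x y) l' = (pidx o x y == 0).
  by rewrite -{1}kA kl incident_aff.
case: (lineP l') kl inl => [o' t'|] kl inl; last first.
  by have := inl 0 0; rewrite incident_aff_inf; case: (o) => [m|] /=;
    rewrite ?star0l ?subr0 eqxx.
(* The image line contains the origin and one further test point, (1,m) or (0,1); comparing these
   determines its slope. *)
have oo : o' = o.
  have := inl 0 0; rewrite incident_aff.
  case: (o) (o') inl => [m|] [m'|] inl //=; rewrite ?star0l ?subr0 eqxx => /eqP t0.
  - have := inl 1 m; rewrite incident_aff /= !star1l -t0 subrr eqxx.
    by rewrite subr_eq0 => /eqP->.
  - have := inl 1 m; rewrite incident_aff /= star1l -t0 subrr eqxx.
    by rewrite oner_eq0.
  - have := inl 0 1; rewrite incident_aff /= star0l -t0 eqxx.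
    by rewrite subr0 oner_eq0.
case E: (k (pdir o)) / (pointP (k (pdir o))) => [x y|o''].
  by case: (@aff_neq_dir x y o); apply: (@perm_inj _ k); rewrite kA E.
by have := kl (pdir o); rewrite E oo !incident_dir eqxx => /eqP->.
Qed.

Lemma Coll_eq_aff (g h : {perm point F}) : g \in Coll F q -> h \in Coll F q ->
  (forall x y, g (aff x y) = h (aff x y)) -> g = h.
Proof.
move=> gC hC gh; apply/eqP; rewrite eq_mulgV1; apply/eqP.
apply: Coll_fix_aff => [|x y]; first by rewrite groupM ?groupV.
by rewrite permM gh permK.
Qed.

(** A collineation is determined by its affine action, so the arbitrary choice in [coll_extending]
    agrees with any explicit collineation. *)
Lemma coll_extendingE (f : F -> F -> point F) (g : {perm point F}) :
  g \in Coll F q -> (forall x y, g (aff x y) = f x y) -> coll_extending q f = g.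
Proof.
move=> gC gf; rewrite /coll_extending; case: pickP => [h /= | /(_ g)].
  case/andP=> hC /forallP hf; apply: Coll_eq_aff => // x y.
  by have /forallP/(_ y)/eqP-> := hf x.
by rewrite gC /= => /negP[]; apply/forallP => x; apply/forallP => y; rewrite gf.
Qed.

Definition pmap (f : F * F -> F * F) (s : option F -> option F) (P : point F) : point F :=
  match pointP P with
  | PointAff x y => aff (f (x, y)).1 (f (x, y)).2
  | PointDir o => pdir (s o)
  end.

Lemma pmap_aff f s (x y : F) : pmap f s (aff x y) = aff (f (x, y)).1 (f (x, y)).2.
Proof.
rewrite /pmap; case E: (aff x y) / (pointP (aff x y)) => [x' y'|o].
  by have [-> ->] := aff_inj E.
by case: (aff_neq_dir E).
Qed.

Lemma pmap_dir f s o : pmap f s (pdir o) = pdir (s o).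
Proof.
rewrite /pmap; case E: (pdir o) / (pointP (pdir o)) => [x y|o'].
  by case: (@aff_neq_dir x y o).
by rewrite (pdir_inj E).
Qed.

Lemma pmap_inj f s : injective f -> injective s -> injective (pmap f s).
Proof.
move=> fI sI P Q; case: (pointP P) => [x y|o]; case: (pointP Q) => [x' y'|o'].
- rewrite !pmap_aff => /aff_inj[E1 E2].
  by have /fI[-> ->] : f (x, y) = f (x', y') 
    by rewrite [LHS]surjective_pairing E1 E2 -surjective_pairing.
- by rewrite pmap_aff pmap_dir => /aff_neq_dir.
- by rewrite pmap_aff pmap_dir => /esym/aff_neq_dir.
- by rewrite !pmap_dir => /pdir_inj/sI->.
Qed.

(** Existence of a collineation is reduced to a computation with affine coordinates; the incidences
    at infinity follow from the injectivity of [s]. *)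
Lemma Coll_of_maps f s : injective f -> injective s ->
  (forall o t, exists t', forall x y,
     (pidx (s o) (f (x, y)).1 (f (x, y)).2 == t') = (pidx o x y == t)) ->
  exists g, [/\ g \in Coll F q,
    forall x y, g (aff x y) = aff (f (x, y)).1 (f (x, y)).2
    & forall o, g (pdir o) = pdir (s o)].
Proof.
move=> fI sI L; exists (perm (pmap_inj fI sI)); split=> [|x y|o]; first last.
- by rewrite permE pmap_dir.
- by rewrite permE pmap_aff.
apply/CollP => l; case: (lineP l) => [o t|].
  have [t' t'E] := L o t; exists (pline (s o) t') => P; rewrite permE.
  case: (pointP P) => [x y|o']; rewrite ?pmap_aff ?pmap_dir.
    by rewrite !incident_aff.
  by rewrite !incident_dir (inj_eq sI).
exists (inf_line F) => P; rewrite permE.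
by case: (pointP P) => [x y|o']; rewrite ?pmap_aff ?pmap_dir
  ?incident_aff_inf ?incident_dir_inf.
Qed.

(* Locked, since failing unifications would otherwise compare collineations by
   evaluating them. *)
Definition lphi : F -> F -> F -> F -> {perm point F} := locked (phi q).

Lemma lphiE : phi q = lphi. Proof. by rewrite /lphi -lock. Qed.

(** The slope map comes from (x ⋆ c) ⋆ (sinv c ⋆ m ⋆ d) = (x ⋆ m) ⋆ d. *)
Lemma lphi_spec (c d u v : F) : c != 0 -> d != 0 ->
  [/\ lphi c d u v \in Coll F q,
      forall x y, lphi c d u v (aff x y) = aff (x ⋆ c + u) (y ⋆ d + v)
    & forall o, lphi c d u v (pdir o) = pdir (omap (fun m => sinv c ⋆ m ⋆ d) o)].
Proof.
move=> c0 d0.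
have [||| g [gC gA gD]] := @Coll_of_maps
    (fun P => (P.1 ⋆ c + u, P.2 ⋆ d + v)) (omap (fun m => sinv c ⋆ m ⋆ d)).
- by move=> [x y] [x' y'] /= [/addIr/(starIr c0)-> /addIr/(starIr d0)->].
- move=> [m|] [m'|] //= [] /(starIr d0)/(starIl (sinv_neq0 c0)) -> //.
- move=> [m|] t /=.
    exists (t ⋆ d + (v - u ⋆ (sinv c ⋆ m ⋆ d))) => x y.
    rewrite starDl opprD addrACA (inj_eq (addIr _)) !starA starKr // -starBl.
    by rewrite (inj_eq (starIr d0)).
  by exists (t ⋆ c + u) => x y; rewrite (inj_eq (addIr _)) (inj_eq (starIr c0)).
by rewrite /lphi -lock /phi (coll_extendingE gC gA).
Qed.

Lemma lphi1 : lphi 1 1 0 0 = 1%g.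
Proof.
rewrite -lphiE /phi (@coll_extendingE _ 1%g) ?group1 // => x y.
by rewrite perm1 !star1r !addr0.
Qed.


(** * Linear collineations and translations *)

(** Exchanging the coordinates turns y = x ⋆ m + t into y = x ⋆ sinv m - t ⋆ sinv m for nonzero m,
    and interchanges the horizontal and vertical directions. *)
Definition swap_dir (o : option F) : option F :=
  if o is Some m then (if m == 0 then None else Some (sinv m)) else Some 0.

Lemma sinv_inj : {in [set~ 0] &, injective sinv}.
Proof.
move=> m m'; rewrite !inE => m0 m0' E; apply: (starIl (sinv_neq0 m0)).
by rewrite /= starVl // E starVl.
Qed.

Lemma swap_dir_inj : injective swap_dir.
Proof.
move=> [m|] [m'|] //=.
- case: eqVneq => [->|m0]; case: eqVneq => [->|m0'] // [] /sinv_inj.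
  by rewrite !inE m0 m0' => ->.
- by case: eqVneq => // m0 [] /eqP; rewrite (negPf (sinv_neq0 m0)).
- by case: eqVneq => // m0 [] /esym/eqP; rewrite (negPf (sinv_neq0 m0)).
Qed.

Definition swap : {perm point F} := locked (gamma q 1 1 0 0).

Lemma swap_exists : exists g, [/\ g \in Coll F q,
  forall x y : F, g (aff x y) = aff y x & forall o, g (pdir o) = pdir (swap_dir o)].
Proof.
apply: (@Coll_of_maps (fun P => (P.2, P.1)) swap_dir).
- by move=> [x y] [x' y'] /= [-> ->].
- exact: swap_dir_inj.
- move=> [m|] t /=; last by exists t => x y; rewrite star0r subr0.
  case: eqVneq => [->|m0] /=; first by exists t => x y; rewrite star0r subr0.
  exists (- (t ⋆ sinv m)) => x y.
  rewrite -[_ == _ in RHS]subr_eq0 -[_ == _ in LHS]subr_eq0.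
  have -> : x - y ⋆ sinv m - - (t ⋆ sinv m) = - ((y - x ⋆ m - t) ⋆ sinv m).
    by rewrite !starBl starKr // opprK !opprB addrC.
  by rewrite oppr_eq0 star_eq0 (negPf (sinv_neq0 m0)) orbF.
Qed.

Lemma swap_spec : [/\ swap \in Coll F q,
  forall x y : F, swap (aff x y) = aff y x & forall o, swap (pdir o) = pdir (swap_dir o)].
Proof.
have [g [gC gA gD]] := swap_exists; suff -> : swap = g by [].
rewrite /swap -lock /gamma; apply: (coll_extendingE gC) => x y.
by rewrite gA !star1r !addr0.
Qed.

(** With the swap factored out, products of linear collineations need only the composition rule of
    [lphi] and one commutation rule. *)
Lemma gammaE (c d u v : F) : c != 0 -> d != 0 ->
  gamma q c d u v = (swap * lphi c d u v)%g.
Proof.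
move=> c0 d0; rewrite /gamma.
move: (lphi c d u v) (lphi_spec u v c0 d0) swap swap_spec => g [gC gA _] s [sC sA _].
by apply: coll_extendingE => [|x y]; rewrite ?groupM // permM sA gA.
Qed.

Lemma lphiM (c d u v c' d' u' v' : F) : c != 0 -> d != 0 -> c' != 0 -> d' != 0 ->
  (lphi c d u v * lphi c' d' u' v')%g =
  lphi (c ⋆ c') (d ⋆ d') (u ⋆ c' + u') (v ⋆ d' + v').
Proof.
move=> c0 d0 c0' d0'; move: (lphi c d u v) (lphi_spec u v c0 d0) => g [gC gA _].
move: (lphi c' d' u' v') (lphi_spec u' v' c0' d0') => h [hC hA _].
move: (lphi _ _ _ _) (lphi_spec (u ⋆ c' + u') (v ⋆ d' + v')
  (star_neq0 c0 c0') (star_neq0 d0 d0')) => k [kC kA _].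
apply: Coll_eq_aff => [||x y]; rewrite ?groupM //.
by rewrite permM gA hA kA !starDl !starA !addrA.
Qed.

Lemma lphi_inj (c d u v c' d' u' v' : F) :
  c != 0 -> d != 0 -> c' != 0 -> d' != 0 ->
  lphi c d u v = lphi c' d' u' v' -> [/\ c = c', d = d', u = u' & v = v'].
Proof.
move=> c0 d0 c0' d0'; move: (lphi c d u v) (lphi_spec u v c0 d0) => g [_ gA _].
move: (lphi c' d' u' v') (lphi_spec u' v' c0' d0') => h [_ hA _] gh.
have := gA 0 0; rewrite gh hA => /aff_inj[]; rewrite !star0l !add0r => uu vv.
by have := gA 1 1; rewrite gh hA => /aff_inj[]; rewrite !star1l uu vv => /addIr-> /addIr->.
Qed.

Lemma lphi_swap (c d u v : F) : c != 0 -> d != 0 ->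
  (lphi c d u v * swap = swap * lphi d c v u)%g.
Proof.
move=> c0 d0; move: (lphi c d u v) (lphi_spec u v c0 d0) => g [gC gA _].
move: (lphi d c v u) (lphi_spec v u d0 c0) swap swap_spec => h [hC hA _] s [sC sA _].
apply: Coll_eq_aff => [||x y]; rewrite ?groupM //.
by rewrite !permM gA !sA hA.
Qed.

Lemma swap2 : (swap * swap = 1)%g.
Proof.
move: swap swap_spec => s [sC sA _].
apply: Coll_eq_aff => [||x y]; rewrite ?groupM ?group1 //.
by rewrite permM !sA perm1.
Qed.

Lemma lphi_linear (c d u v : F) : c != 0 -> d != 0 ->
  lphi c d u v \in linear_colls F q.
Proof.
move=> c0 d0; rewrite inE lphiE; apply/existsP; exists c; apply/existsP; exists d.
by apply/existsP; exists u; apply/existsP; exists v; rewrite c0 d0 eqxx.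
Qed.

Lemma linearP (g : {perm point F}) :
  reflect (exists c d u v, [/\ c != 0, d != 0 &
            g = lphi c d u v \/ g = (swap * lphi c d u v)%g])
          (g \in linear_colls F q).
Proof.
rewrite inE lphiE; apply: (iffP idP).
  case/existsP=> c /existsP[d /existsP[u /existsP[v]]].
  case/and3P=> c0 d0; rewrite gammaE // => gE; exists c, d, u, v; split=> //.
  by case/orP: gE => /eqP gE; [left | right].
case=> c [d [u [v [c0 d0 gE]]]]; apply/existsP; exists c; apply/existsP; exists d.
apply/existsP; exists u; apply/existsP; exists v; rewrite c0 d0 gammaE //=.
by case: gE => ->; rewrite eqxx ?orbT.
Qed.

Lemma linear_group_set : group_set (linear_colls F q).
Proof.
have one0 : (1 : F) != 0 := oner_neq0 F.
apply/group_setP; split; first by rewrite -lphi1 lphi_linear.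
move=> g h /linearP[c [d [u [v [c0 d0 gE]]]]] /linearP[c' [d' [u' [v' [c0' d0' hE]]]]].
apply/linearP; case: hE => ->.
  exists (c ⋆ c'), (d ⋆ d'), (u ⋆ c' + u'), (v ⋆ d' + v').
  rewrite -lphiM //; split; [exact: star_neq0 | exact: star_neq0 |].
  by case: gE => ->; [left | right; rewrite mulgA].
exists (d ⋆ c'), (c ⋆ d'), (v ⋆ c' + u'), (u ⋆ d' + v').
rewrite -lphiM //; split; [exact: star_neq0 | exact: star_neq0 |].
have E := lphi_swap u v c0 d0; case: gE => ->; [right | left].
  by rewrite mulgA E mulgA.
by rewrite -mulgA (mulgA _ swap) E !mulgA swap2 mul1g.
Qed.

(** The nearfield powers of c and d appear as values at 1 of powers of [rmul]. The translation part
    stays unspecified: the aim is only to see when a power is a translation. *)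
Lemma lphi_expg (c d u v : F) n : c != 0 -> d != 0 ->
  exists u' v', (lphi c d u v ^+ n)%g = lphi ((rmul c ^+ n)%g 1) ((rmul d ^+ n)%g 1) u' v'.
Proof.
move=> c0 d0; have rn0 (b : F) k : b != 0 -> (rmul b ^+ k)%g 1 != 0.
  move=> b0; elim: k => [|k IH]; first by rewrite perm1 oner_neq0.
  by rewrite expgSr permM rmulE // star_neq0.
elim: n => [|n [u' [v' E]]]; first by exists 0, 0; rewrite !expg0 !perm1 lphi1.
exists (u' ⋆ c + u), (v' ⋆ d + v).
by rewrite expgSr E lphiM ?rn0 // !expgSr !permM !rmulE.
Qed.

Lemma translationsP (g : {perm point F}) :
  reflect (exists u v, g = lphi 1 1 u v) (g \in translations F q).
Proof.
apply: (iffP imset2P) => [[u v _ _ ->]|[u [v ->]]]; first by exists u, v; rewrite lphiE.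
by exists u v; rewrite ?lphiE.
Qed.

Lemma translation_group_set : group_set (translations F q).
Proof.
have one0 : (1 : F) != 0 := oner_neq0 F.
apply/group_setP; split; first by apply/translationsP; exists 0, 0; rewrite lphi1.
move=> _ _ /translationsP[u [v ->]] /translationsP[u' [v' ->]].
by apply/translationsP; exists (u + u'), (v + v'); rewrite lphiM // !star1r.
Qed.

(** Squaring removes the swap, and the multiplicative group of the nearfield has order q^2 - 1, so
    the remaining exponent trivializes the multiplicative parts. *)
Lemma linear_expg (g : {perm point F}) : g \in linear_colls F q ->
  (g ^+ (2 * (q ^ 2).-1))%g \in translations F q.
Proof.
have phiX (c d u v : F) : c != 0 -> d != 0 ->
    (lphi c d u v ^+ (q ^ 2).-1)%g \in translations F q.
  move=> c0 d0; have [u' [v' ->]] := lphi_expg u v (q ^ 2).-1 c0 d0.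
  by rewrite !rmulX_q2 // !perm1; apply/translationsP; exists u', v'.
case/linearP=> c [d [u [v [c0 d0 gE]]]]; rewrite expgM.
have -> : (g ^+ 2 = g * g)%g by rewrite expgS expg1.
case: gE => ->; first by rewrite lphiM // phiX ?star_neq0.
rewrite -mulgA (mulgA _ swap) lphi_swap // !mulgA swap2 mul1g.
by rewrite lphiM // phiX ?star_neq0.
Qed.

Lemma AutUP (U : {set point F}) (g : {perm point F}) :
  reflect (g \in Coll F q /\ forall P, (g P \in U) = (P \in U)) (g \in AutU q U).
Proof.
apply: (iffP setIP) => -[gC gU]; split=> //.
  by move=> P; have := astabsP gU P; rewrite /= /aperm.
by apply/astabsP => P; rewrite /= /aperm.
Qed.

(* By [linear_expg] a Sylow p-subgroup consists of translations. *)
Lemma q_dvd_translations (U : {set point F}) :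
  (q %| #|AutU q U :&: linear_colls F q|)%N ->
  (q %| #|AutU q U :&: translations F q|)%N.
Proof.
move=> qG; pose G := (AutU q U :&: group linear_group_set)%G.
pose T := (AutU q U :&: group translation_group_set)%G.
have [P sylP] := Sylow_exists p G.
have qP : (q %| #|P|)%N.
  rewrite (card_Hall sylP) -(part_pnat_id (n := q) (pi := p)) ?partn_dvd ?cardG_gt0 //.
  by rewrite qE pnatX pnat_id.
suff sPT : P \subset T by apply: dvdn_trans qP (cardSg sPT).
have copN : coprime #|P| (2 * (q ^ 2).-1).
  apply: (@pnat_coprime p); first exact: pHall_pgroup sylP.
  rewrite p'natE // Euclid_dvdM // negb_or dvdn_prime2 //.
  apply/andP; split; first by apply: contraL p_odd => /eqP->.
  apply/negP => pq; have : (p %| q ^ 2)%N by rewrite qE -expnM dvdn_exp ?muln_gt0 ?e_gt0.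
  rewrite -[(q ^ 2)%N]prednK ?expn_gt0 ?q_gt0 // -addn1 dvdn_addr // dvdn1.
  by move: p_prime => /[swap] /eqP->.
(* The exponent is prime to the order of [P], so g is itself a power of the translation given by
   [linear_expg]. *)
apply/subsetP => g Pg; have Gg := subsetP (pHall_sub sylP) _ Pg.
case/setIP: Gg => gA gL; rewrite inE gA /= -(expgK copN Pg).
exact: (@groupX _ (group translation_group_set) _ _ (linear_expg gL)).
Qed.

Definition tvec (U : {set point F}) : {set F * F} :=
  [set w : F * F | lphi 1 1 w.1 w.2 \in AutU q U].

Lemma card_tvec (U : {set point F}) : #|tvec U| = #|AutU q U :&: translations F q|.
Proof.
have one0 : (1 : F) != 0 := oner_neq0 F.
have -> : AutU q U :&: translations F q = [set lphi 1 1 w.1 w.2 | w in tvec U].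
  apply/setP => g; apply/setIP/imsetP => [[gA /translationsP[u [v gE]]]|[w wT ->]].
    by exists (u, v) => //; rewrite inE -gE.
  by move: wT; rewrite inE => ->; split=> //; apply/translationsP; exists w.1, w.2.
by rewrite card_imset // => -[u v] [u' v'] /= /lphi_inj[] // _ _ -> ->.
Qed.


(** * Tangents in a parallel class *)

Definition aset (U : {set point F}) : {set F * F} := [set w | aff w.1 w.2 \in U].

Definition aline (U : {set point F}) o (t : F) : {set F * F} :=
  [set w in aset U | pidx o w.1 w.2 == t].

Definition tangent_idx (U : {set point F}) o : {set F} :=
  [set t | tangent q U (pline o t)].

Lemma aff_pair_inj : injective (fun w : F * F => aff w.1 w.2).
Proof. by move=> [x y] [x' y'] /aff_inj[/= -> ->]. Qed.

Lemma card_aline (U : {set point F}) o t :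
  #|points_on q (pline o t) :&: U| = ((pdir o \in U) + #|aline U o t|)%N.
Proof.
rewrite (cardsD1 (pdir o)) !inE incident_dir eqxx /=; congr (_ + _)%N.
rewrite -(card_imset _ aff_pair_inj); apply: eq_card => P; rewrite !inE.
case: (pointP P) => [x y|o'].
  rewrite incident_aff; have -> : aff x y != pdir o by apply/eqP/aff_neq_dir.
  rewrite /=.
  apply/andP/imsetP => [[xy xU]|[w]]; first by exists (x, y); rewrite ?inE //= xU.
  by rewrite !inE => /andP[wU wt] /aff_inj[-> ->].
rewrite incident_dir (inj_eq pdir_inj) andbA andNb; apply/esym/imsetP.
by case=> w _ /esym/aff_neq_dir.
Qed.

Lemma card_aset (U : {set point F}) :
  #|U| = (#|points_on q (inf_line F) :&: U| + #|aset U|)%N.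
Proof.
rewrite -(cardsID (points_on q (inf_line F)) U) setIC; congr (_ + _)%N.
rewrite -(card_imset _ aff_pair_inj); apply: eq_card => P; rewrite !inE.
case: (pointP P) => [x y|o']; rewrite ?incident_aff_inf ?incident_dir_inf /=.
  apply/idP/imsetP => [xU|[w]]; first by exists (x, y); rewrite ?inE.
  by rewrite !inE => wU /aff_inj[-> ->].
by apply/esym/imsetP; case=> w _ /esym/aff_neq_dir.
Qed.

Lemma sum_card_aline (U : {set point F}) o : (\sum_t #|aline U o t| = #|aset U|)%N.
Proof.
rewrite -[RHS]sum1_card (partition_big (fun w => pidx o w.1 w.2) xpredT) //=.
by apply: eq_bigr => t _; rewrite -sum1_card; apply: eq_bigl => w; rewrite inE.
Qed.

(** Tangents and secants differ by q points, so adding q for a tangent gives the same value on all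
    lines of a parallel class. In this form the count can be summed over t. *)
Lemma card_aline_tangent (U : {set point F}) o t : unital q U ->
  (#|aline U o t| + tangent q U (pline o t) * q = if pdir o \in U then q else q.+1)%N.
Proof.
case=> _ /(_ (pline o t)); rewrite /tangent /secant card_aline.
case: (pdir o \in U); rewrite ?add1n ?add0n ?eqSS.
  by case/orP=> /eqP ->; rewrite ?eqxx ?mul1n // (gtn_eqF q_gt0) addn0.
by case/orP=> /eqP ->; rewrite ?eqxx ?mul1n // eqSS (gtn_eqF q_gt0) addn0.
Qed.

(** The q^2 lines of a parallel class partition the affine points of [U]. *)
Lemma card_tangent_idx (U : {set point F}) o : unital q U ->
  (#|aset U| + q * #|tangent_idx U o| = q ^ 2 * if pdir o \in U then q else q.+1)%N.
Proof.
move=> uU; rewrite -(sum_card_aline U o) -cardF -sum_nat_const.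
under [RHS]eq_bigr => t _ do rewrite -(card_aline_tangent o t uU).
rewrite big_split /= -big_distrl /= [(q * _)%N]mulnC; congr (_ + _ * _)%N.
by rewrite -sum1dep_card big_mkcond; apply: eq_bigr => t _; case: ifP.
Qed.

Lemma card_tangent_idx_parabolic (U : {set point F}) o : unital q U -> parabolic q U ->
  #|tangent_idx U o| = if pdir o \in U then 0%N else q.
Proof.
move=> uU /eqP pU; have := card_tangent_idx o uU.
have := card_aset U; rewrite pU uU.1 add1n => -[<-].
case: ifP => _; rewrite ?mulnSr -expnSr => /eqP.
  by rewrite -[X in _ == X]addn0 eqn_add2l muln_eq0 (gtn_eqF q_gt0) => /eqP.
by rewrite eqn_add2l -[(q ^ 2)%N]mulnn eqn_pmul2l ?q_gt0 // => /eqP.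
Qed.

(** Here [U] has q^3 - q affine points, so the count leaves q times the number of tangents equal to
    q. *)
Lemma card_tangent_idx_secant (U : {set point F}) o : unital q U ->
  secant q U (inf_line F) -> pdir o \in U -> #|tangent_idx U o| = 1%N.
Proof.
move=> uU /eqP sU oU; have := card_tangent_idx o uU; rewrite oU.
have := card_aset U; rewrite sU uU.1 addSn => -[qE3].
rewrite -expnSr qE3 addnC => /addIn/eqP.
by rewrite -{2}[q]muln1 eqn_pmul2l ?q_gt0 // => /eqP.
Qed.

Lemma incident_translate (u v : F) o t (P : point F) :
  incident q (lphi 1 1 u v P) (pline o (t + pidx o u v)) = incident q P (pline o t).
Proof.
have [_ A D] := lphi_spec u v (oner_neq0 F) (oner_neq0 F).
case: (pointP P) => [x y|o']; rewrite ?A ?D.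
  by rewrite !star1r !incident_aff pidxD (inj_eq (addIr _)).
rewrite !incident_dir; case: o' => [m|] //=.
by rewrite star1r -[in LHS](star1l (_ ⋆ m)) starA starVr ?oner_neq0 // star1l.
Qed.

Lemma card_coll_line (U : {set point F}) (g : {perm point F}) l l' :
  (forall P, incident q (g P) l' = incident q P l) ->
  #|points_on q l' :&: g @: U| = #|points_on q l :&: U|.
Proof.
move=> gl; have gI := @perm_inj _ g.
rewrite -[RHS](card_imset _ gI); apply: eq_card => P.
by rewrite -[P](permKV g) (mem_imset _ _ gI) !in_setI (mem_imset _ _ gI) !inE gl.
Qed.

Lemma imset_AutU (U : {set point F}) (g : {perm point F}) :
  g \in AutU q U -> g @: U = U.
Proof.
case/AutUP => _ gU; apply/setP => P.
by rewrite -[P](permKV g) mem_imset ?gU //; apply: perm_inj.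
Qed.

(** * Translations preserving a unital *)

Section Translations.

Variable U : {set point F}.

Lemma mem_tvec (u v : F) : ((u, v) \in tvec U) = (lphi 1 1 u v \in AutU q U).
Proof. by rewrite [LHS]inE. Qed.

Lemma asetE (x y : F) : ((x, y) \in aset U) = (aff x y \in U).
Proof. by rewrite [LHS]inE. Qed.

Lemma aset_tvec (x y u v : F) : (u, v) \in tvec U ->
  ((x + u, y + v) \in aset U) = ((x, y) \in aset U).
Proof.
have [_ A _] := lphi_spec u v (oner_neq0 F) (oner_neq0 F).
rewrite mem_tvec !asetE => /AutUP[_ gU].
by rewrite -[RHS]gU A !star1r.
Qed.

Lemma tangent_idx_tvec (u v t : F) o : (u, v) \in tvec U ->
  (t + pidx o u v \in tangent_idx U o) = (t \in tangent_idx U o).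
Proof.
rewrite mem_tvec => gA; rewrite !inE /tangent.
by rewrite -{1}(imset_AutU gA) (card_coll_line U (incident_translate u v o t)).
Qed.

Lemma tvec0 : (0, 0) \in tvec U. Proof. by rewrite mem_tvec lphi1 group1. Qed.

Lemma tvecD (u v u' v' : F) : (u, v) \in tvec U -> (u', v') \in tvec U ->
  (u + u', v + v') \in tvec U.
Proof.
rewrite !mem_tvec => g h; have := groupM g h.
by rewrite lphiM ?oner_neq0 // !star1r.
Qed.

Hypotheses (uU : unital q U) (vU : vert_pt F \in U) (qtvec : (q %| #|tvec U|)%N).

(* Two points of [U] at infinity each have a unique, affine tangent, which every
   translation preserving [U] must fix. *)
Lemma tvec_secant_fix : secant q U (inf_line F) -> tvec U = [set (0, 0)].
Proof.
move=> sU; have fix_idx o u v : pdir o \in U -> (u, v) \in tvec U -> pidx o u v = 0.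
  move=> oU uv; have /eqP/cards1P[t tE] := card_tangent_idx_secant uU sU oU.
  have := tangent_idx_tvec t o uv; rewrite tE !inE eqxx => /eqP.
  by rewrite -{2}[t]addr0 => /addrI.
have [m mU] : exists m, slope_pt m \in U.
  have : (1 < #|points_on q (inf_line F) :&: U|)%N by rewrite (eqP sU) ltnS q_gt0.
  rewrite (cardsD1 (vert_pt F)) -[X in (X < _)%N]addn1 => H.
  have /card_gt0P[P] : (0 < #|(points_on q (inf_line F) :&: U) :\ vert_pt F|)%N.
    by move: H; case: (_ \in _); rewrite ?add0n ?add1n ?addn1 ?ltnS //; apply: leq_trans.
  rewrite !inE => /and3P[Pv Pi PU]; case: (pointP P) Pv Pi PU => [x y|[m|]].
  - by rewrite incident_aff_inf.
  - by exists m.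
  - by rewrite eqxx.
apply/setP => -[u v]; rewrite in_set1; apply/idP/eqP => [uv|[-> ->]]; last exact: tvec0.
have u0 : u = 0 := fix_idx None u v vU uv.
have := fix_idx (Some m) u v mU uv; rewrite u0 /= star0l subr0 => v0.
by rewrite v0.
Qed.

(** If the line at infinity were secant, only the identity translation would remain, and q > 2 would
    divide 1. *)
Lemma parabolic_of_tvec : parabolic q U.
Proof.
have := uU.2 (inf_line F) => /orP[//|/tvec_secant_fix TE].
by move: qtvec; rewrite TE cards1 dvdn1 => /eqP qE1; have := q_gt2; rewrite qE1.
Qed.

Lemma pdir_in_U o : (pdir o \in U) = (o == None).
Proof.
have /eqP/eqP/cards1P[P PE] := parabolic_of_tvec.
have in_inf o' : pdir o' \in U -> pdir o' = P.
  by move=> oU; apply/set1P; rewrite -PE !inE incident_dir_inf.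
apply/idP/eqP => [oU|-> //]; apply: pdir_inj.
by rewrite (in_inf _ oU) -(in_inf None).
Qed.

Lemma card_tangent_idx_Some m : #|tangent_idx U (Some m)| = q.
Proof. by rewrite card_tangent_idx_parabolic ?parabolic_of_tvec // pdir_in_U. Qed.

Lemma tangent_idxE m t : t \in tangent_idx U (Some m) -> exists w, aline U (Some m) t = [set w].
Proof.
rewrite inE /tangent card_aline pdir_in_U add0n => /cards1P[w ->]; by exists w.
Qed.

(** The tangent at (0,1,0) is the line at infinity, so every vertical affine line is a secant. *)
Lemma card_aline_vert t : #|aline U None t| = q.
Proof.
have /eqP := card_tangent_idx_parabolic None uU parabolic_of_tvec; rewrite vU.
rewrite cards_eq0 => /eqP T0; have := card_aline_tangent None t uU; rewrite vU.
have -> : tangent q U (pline None t) = false.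
  by apply/negP => tT; have := in_set0 t; rewrite -T0 inE tT.
by rewrite addn0.
Qed.

(* A translation in direction [m] fixes the tangents of slope [m] with their
   affine point of contact. *)
Lemma tvec_vert (u v : F) : (u, v) \in tvec U -> u = 0.
Proof.
move=> uv; case: (eqVneq u 0) => // u0; pose m := sinv u ⋆ v.
have um : pidx (Some m) u v = 0 by rewrite /= /m starA starVr // star1l subrr.
have /card_gt0P[t tT] : (0 < #|tangent_idx U (Some m)|)%N.
  by rewrite card_tangent_idx_Some q_gt0.
have [[x y] xyE] := tangent_idxE tT.
have : (x, y) \in aline U (Some m) t by rewrite xyE inE.
rewrite inE => /andP[xA xt]; have : (x + u, y + v) \in aline U (Some m) t.
  by rewrite inE aset_tvec // xA [fst _]/= [snd _]/= pidxD um addr0 xt.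
rewrite xyE inE => /eqP[xu _]; move/eqP: xu.
by rewrite -{2}[x]addr0 (inj_eq (addrI _)) => /eqP.
Qed.

(** By [tvec_vert] this set records all translations preserving [U]. That it also describes [U] on
    the line x = 0 needs the origin in [U] and is shown in [aset0]. *)
Definition Wset : {set F} := [set v | (0, v) \in tvec U].

Lemma WsetE v : (v \in Wset) = ((0, v) \in tvec U).
Proof. by rewrite [LHS]inE. Qed.

Lemma tvec_Wset (u v : F) : ((u, v) \in tvec U) = (u == 0) && (v \in Wset).
Proof.
apply/idP/andP => [uv|[/eqP->]]; last by rewrite WsetE.
by have u0 := tvec_vert uv; rewrite WsetE -u0 uv eqxx.
Qed.

Lemma WsetD (v w : F) : v \in Wset -> w \in Wset -> v + w \in Wset.
Proof. by rewrite !WsetE => /tvecD H /H; rewrite addr0. Qed.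

Lemma Wset0 : 0 \in Wset. Proof. by rewrite WsetE tvec0. Qed.

Lemma card_Wset_tvec : #|Wset| = #|tvec U|.
Proof.
rewrite -(card_imset _ (fun v v' (E : (0 : F, v) = (0, v')) => congr1 snd E)).
apply: eq_card => -[u v]; apply/imsetP/idP => [[w wW [-> ->]]|].
  by rewrite tvec_Wset eqxx.
by rewrite tvec_Wset => /andP[/eqP-> vW]; exists v.
Qed.

(** Divisibility by q gives the lower bound. For the upper bound, the translates of one affine point
    of [U] all lie among the q affine points of [U] on its vertical line. *)
Lemma card_Wset : #|Wset| = q.
Proof.
apply/eqP; rewrite eqn_leq; apply/andP; split; last first.
  apply: dvdn_leq; first by apply/card_gt0P; exists 0; apply: Wset0.
  by rewrite card_Wset_tvec.
have /card_gt0P[[x y]] : (0 < #|aline U None 0%R|)%N by rewrite card_aline_vert q_gt0.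
rewrite inE => /andP[xy /eqP/= x0]; rewrite x0 in xy.
rewrite -(card_aline_vert 0) -(card_imset _ (addrI y)).
rewrite -(card_imset _ (fun v v' (E : (0 : F, v) = (0, v')) => congr1 snd E)).
apply/subset_leq_card/subsetP => _ /imsetP[_ /imsetP[w wW ->] ->].
rewrite inE [fst _]/= eqxx andbT -[X in (X, _)]addr0 aset_tvec //.
by move: wW; rewrite WsetE.
Qed.

(** The q translates of (x,y) fill the q affine points of [U] on the vertical line through it. *)
Lemma aset_vert (x y y' : F) : (x, y) \in aset U ->
  ((x, y') \in aset U) = (y' - y \in Wset).
Proof.
move=> xy; have sub w : w \in Wset -> (x, y + w) \in aset U.
  by rewrite WsetE => wT; rewrite -[x]addr0 aset_tvec.
apply/idP/idP => [xy'|/sub]; last by rewrite addrCA subrr addr0.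
pose S := [set (x, y + w) | w in Wset].
have inj : injective (fun w => (x, y + w)) by move=> w w' [] /addrI.
have /eqP SE : S == aline U None x.
  rewrite eqEcard card_imset // card_Wset card_aline_vert leqnn andbT.
  by apply/subsetP => _ /imsetP[w /sub wA ->]; rewrite inE wA /=.
have : (x, y') \in S by rewrite SE inE xy' /=.
by case/imsetP => w wW [->]; rewrite addrC addKr.
Qed.

End Translations.


(** * Unitals in normal form *)

Section NormalForm.

Variable U : {set point F}.
Hypotheses (uU : unital q U) (vU : vert_pt F \in U) (qtvec : (q %| #|tvec U|)%N).
Hypotheses (U0 : aff 0 0 \in U) (tangent0 : 0 \in tangent_idx U (Some 0)).

Local Notation W := (Wset U).

Lemma card_W : #|W| = q. Proof. exact: card_Wset. Qed.

Lemma aset0 (y : F) : ((0, y) \in aset U) = (y \in W).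
Proof. by rewrite (@aset_vert U uU vU qtvec 0 0 y) ?subr0 // asetE. Qed.

Lemma WsetN (v : F) : v \in W -> - v \in W.
Proof.
rewrite -aset0 => vA; have := aset_vert uU vU qtvec 0 vA.
by rewrite asetE U0 sub0r => <-.
Qed.

Lemma WsetB (v w : F) : v \in W -> w \in W -> v - w \in W.
Proof. by move=> vW wW; rewrite WsetD ?WsetN. Qed.

(** Translating the tangent y = 0 by [W] gives q horizontal tangents, and there are no more than
    q. *)
Lemma tangent_idx_horizontal : tangent_idx U (Some 0) = W.
Proof.
apply/esym/eqP; rewrite eqEcard card_W card_tangent_idx_Some // leqnn andbT.
apply/subsetP => w; rewrite WsetE => /(tangent_idx_tvec 0 (Some 0)).
by rewrite tangent0 /= star0l subr0 add0r.
Qed.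

Lemma aline_horizontal (w : F) : w \in W -> aline U (Some 0) w = [set (0, w)].
Proof.
move=> wW; have : w \in tangent_idx U (Some 0) by rewrite tangent_idx_horizontal.
case/(tangent_idxE uU vU qtvec) => z zE; rewrite zE.
have : (0, w) \in aline U (Some 0) w by rewrite inE aset0 wW /= star0l subr0 eqxx.
by rewrite zE inE => /eqP->.
Qed.

Lemma aset_W (x y : F) : (x, y) \in aset U -> y \in W -> x = 0.
Proof.
move=> xyA yW; have : (x, y) \in aline U (Some 0) y.
  by rewrite inE xyA /= star0r subr0 eqxx.
by rewrite aline_horizontal // inE => /eqP[].
Qed.

(** * Linear automorphisms and their diagonal parts *)

Definition diag : {set F * F} :=
  [set w | [&& w.1 != 0, w.2 != 0 & lphi w.1 w.2 0 0 \in AutU q U]].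

Lemma diagP (c d : F) : reflect [/\ c != 0, d != 0 & lphi c d 0 0 \in AutU q U]
                               ((c, d) \in diag).
Proof. by rewrite [_ \in diag]inE; apply: and3P. Qed.

Lemma incident_lphi_horizontal (c d u v t : F) (P : point F) : c != 0 -> d != 0 ->
  incident q (lphi c d u v P) (pline (Some 0) (t ⋆ d + v)) =
  incident q P (pline (Some 0) t).
Proof.
move=> c0 d0; have [_ A D] := lphi_spec u v c0 d0.
case: (pointP P) => [x y|[m|]]; rewrite ?A ?D.
- by rewrite !incident_aff /= !star0r !subr0 (inj_eq (addIr _)) (inj_eq (starIr d0)).
- rewrite !incident_dir /= !(inj_eq (@Some_inj _)) !star_eq0.
  by rewrite (negPf d0) (negPf (sinv_neq0 c0)) orbF.
- by rewrite !incident_dir.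
Qed.

Lemma aset_lphi (c d u v x y : F) : c != 0 -> d != 0 -> lphi c d u v \in AutU q U ->
  ((x ⋆ c + u, y ⋆ d + v) \in aset U) = ((x, y) \in aset U).
Proof.
move=> c0 d0 /AutUP[_ gU]; have [_ A _] := lphi_spec u v c0 d0.
by rewrite !asetE -A gU.
Qed.

(** The tangent y = 0 goes to the horizontal tangent at height v, so v lies in [W]. The image (u,v)
    of the origin is then its point of contact, which has first coordinate 0. *)
Lemma lphi_fix_origin (c d u v : F) : c != 0 -> d != 0 -> lphi c d u v \in AutU q U ->
  u = 0 /\ v \in W.
Proof.
move=> c0 d0 gA; have vW : v \in W.
  have := card_coll_line U (fun P => incident_lphi_horizontal u v 0 P c0 d0).
  rewrite (imset_AutU gA) star0l add0r -tangent_idx_horizontal inE /tangent => ->.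
  by move: tangent0; rewrite inE.
split=> //; apply: aset_W vW.
by have := aset_lphi 0 0 c0 d0 gA; rewrite !star0l !add0r asetE U0 => ->.
Qed.

Lemma Wset_phi1 (w : F) : (w \in W) = (lphi 1 1 0 w \in AutU q U).
Proof. by rewrite WsetE mem_tvec. Qed.

Lemma lphi_split (c d v : F) : c != 0 -> d != 0 ->
  lphi c d 0 v = (lphi c d 0 0 * lphi 1%R 1%R 0 v)%g.
Proof. by move=> c0 d0; rewrite lphiM ?oner_neq0 // !star1r !add0r. Qed.

Lemma AutU_lphi (c d v : F) : v \in W -> c != 0 -> d != 0 ->
  (lphi c d 0 v \in AutU q U) = (lphi c d 0 0 \in AutU q U).
Proof. by rewrite Wset_phi1 => vA c0 d0; rewrite lphi_split // groupMr. Qed.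

(** Such a collineation moves (0,1,0), the only point of [U] at infinity, to another point at
    infinity. *)
Lemma swap_notin_AutU (c d u v : F) : c != 0 -> d != 0 ->
  (swap * lphi c d u v)%g \notin AutU q U.
Proof.
move=> c0 d0; apply/negP => /AutUP[_ /(_ (pdir None))].
have [_ _ sD] := swap_spec; have [_ _ D] := lphi_spec u v c0 d0.
by rewrite permM sD D /= vU (pdir_in_U uU vU qtvec (Some _)).
Qed.

Lemma linearAutP (g : {perm point F}) :
  reflect (exists c d v, [/\ (c, d) \in diag, v \in W & g = lphi c d 0 v])
          (g \in AutU q U :&: linear_colls F q).
Proof.
apply: (iffP setIP) => [[gA /linearP[c [d [u [v [c0 d0 gE]]]]]]|].
  case: gE gA => -> gA; last by case/negP: (swap_notin_AutU u v c0 d0).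
  have [u0 vW] := lphi_fix_origin c0 d0 gA; exists c, d, v; split; rewrite ?u0 //.
  by apply/diagP; split=> //; rewrite -(AutU_lphi vW) // -u0.
case=> c [d [v [/diagP[c0 d0 gA] vW ->]]].
by split; [rewrite AutU_lphi | apply: lphi_linear].
Qed.

Lemma translationAutP (g : {perm point F}) :
  reflect (exists2 w, w \in W & g = lphi 1 1 0 w) (g \in AutU q U :&: translations F q).
Proof.
apply: (iffP setIP) => [[gA /translationsP[u [v gE]]]|[w wW ->]].
  have [u0 vW] : u = 0 /\ v \in W.
    by apply: (@lphi_fix_origin 1 1); rewrite ?oner_neq0 // -gE.
  by exists v; rewrite // gE u0.
by rewrite -Wset_phi1; split=> //; apply/translationsP; exists 0, w.
Qed.

Lemma R0hatP (g : {perm point F}) :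
  reflect (exists c d, [/\ c != 0, d != 0 & g = lphi c d 0 0]) (g \in R0hat F q).
Proof.
apply: (iffP imset2P) => [[c d]|[c [d [c0 d0 ->]]]].
  by rewrite !inE lphiE => c0 d0 ->; exists c, d.
by exists c d; rewrite ?inE ?lphiE.
Qed.

Lemma diagAutP (g : {perm point F}) :
  reflect (exists c d, (c, d) \in diag /\ g = lphi c d 0 0)
          (g \in AutU q U :&: linear_colls F q :&: R0hat F q).
Proof.
apply: (iffP setIP) => [[/setIP[gA _] /R0hatP[c [d [c0 d0 gE]]]]|].
  by exists c, d; split=> //; apply/diagP; rewrite -gE.
case=> c [d [cd ->]]; have [c0 d0 gA] := diagP _ _ cd; split.
  by apply/linearAutP; exists c, d, 0; split=> //; apply: Wset0.
by apply/R0hatP; exists c, d.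
Qed.

Lemma phi_in_G1 (c d : F) : c != 0 -> d != 0 ->
  (lphi c d 0 0 \in AutU q U :&: linear_colls F q :&: R0hat F q) = ((c, d) \in diag).
Proof.
move=> c0 d0; apply/diagAutP/idP => [[c' [d' [cd E]]]|cd]; last by exists c, d.
have [c0' d0' _] := diagP _ _ cd.
by have [-> -> _ _] := lphi_inj c0 d0 c0' d0' E.
Qed.

Lemma card_G : #|AutU q U :&: linear_colls F q| = (q * #|diag|)%N.
Proof.
have -> : AutU q U :&: linear_colls F q =
    [set lphi z.1.1 z.1.2 0 z.2 | z in setX diag W].
  apply/setP => g; apply/linearAutP/imsetP => [[c [d [v [cd vW ->]]]]|[[[c d] v]]].
    by exists ((c, d), v); rewrite // in_setX cd.
  by rewrite in_setX => /andP[cd vW] ->; exists c, d, v.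
rewrite card_in_imset ?cardsX ?card_W 1?mulnC // => -[[c d] v] [[c' d'] v'].
rewrite !in_setX /= => /andP[/diagP[c0 d0 _] _] /andP[/diagP[c0' d0' _] _].
by case/(lphi_inj c0 d0 c0' d0') => -> -> _ ->.
Qed.

Lemma card_G1 : #|AutU q U :&: linear_colls F q :&: R0hat F q| = #|diag|.
Proof.
have -> : AutU q U :&: linear_colls F q :&: R0hat F q =
    [set lphi z.1 z.2 0 0 | z in diag].
  apply/setP => g; apply/diagAutP/imsetP => [[c [d [cd ->]]]|[[c d] cd ->]].
    by exists (c, d).
  by exists c, d.
rewrite card_in_imset // => -[c d] [c' d'] /diagP[c0 d0 _] /diagP[c0' d0' _] /=.
by case/(lphi_inj c0 d0 c0' d0') => -> ->.
Qed.

Lemma diagM (c d c' d' : F) : (c, d) \in diag -> (c', d') \in diag ->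
  (c ⋆ c', d ⋆ d') \in diag.
Proof.
move=> /diagP[c0 d0 gA] /diagP[c0' d0' gA']; apply/diagP; rewrite !star_neq0 //.
by have := groupM gA gA'; rewrite lphiM // !star0l !add0r.
Qed.

Lemma diag1 : (1, 1) \in diag.
Proof. by apply/diagP; rewrite !oner_neq0 lphi1 group1. Qed.

Lemma diagV (c d : F) : (c, d) \in diag -> (sinv c, sinv d) \in diag.
Proof.
move=> /diagP[c0 d0 gA]; apply/diagP; rewrite !sinv_neq0 //; split=> //.
rewrite -(groupMl _ gA) lphiM ?sinv_neq0 // !starVr // !star0l !add0r lphi1.
exact: group1.
Qed.

Lemma diag_W (c d w : F) : (c, d) \in diag -> w \in W -> w ⋆ d \in W.
Proof.
case/diagP=> c0 d0 gA; rewrite -!aset0 -(aset_lphi 0 w c0 d0 gA).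
by rewrite star0l !addr0.
Qed.

(* If [d] is not 1 then [w |-> w ⋆ d - w] permutes [W], so that the second
   coordinates of the affine points of [U] all lie in [W]. *)
Lemma diag1r (d : F) : (1, d) \in diag -> d = 1.
Proof.
move=> dG; have [_ d0 gA] := diagP _ _ dG; apply/eqP; apply: contraT => d1.
pose f w : F := w ⋆ d - w.
have fI : injective f.
  have fB x y : f (x - y) = f x - f y.
    by rewrite /f starBl !opprD !opprK addrACA.
  move=> x y /eqP; rewrite -subr_eq0 -fB subr_eq0 => /eqP E; apply/eqP.
  by rewrite -subr_eq0; apply: contraNT d1 => xy0; apply/eqP/(star_fix xy0).
have /eqP fW : f @: W == W.
  rewrite eqEcard card_imset // leqnn andbT.
  by apply/subsetP => _ /imsetP[w wW ->]; rewrite WsetB // (diag_W dG).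
(* A point (1,y) of [U] is sent to (1, y ⋆ d) on the same vertical line, so [f y] lies in [W], which
   is [f @: W]. Then y lies in [W], forcing the first coordinate to be 0. *)
have /card_gt0P[[x y]] : (0 < #|aline U None 1%R|)%N by rewrite card_aline_vert ?q_gt0.
rewrite inE => /andP[xyA /= x1]; have : f y \in W.
  rewrite -(aset_vert uU vU qtvec _ xyA).
  have := aset_lphi x y (oner_neq0 F) d0 gA.
  by rewrite star1r !addr0 => ->.
rewrite -fW => /imsetP[w wW /fI yw].
by move: x1; rewrite (aset_W xyA) ?yw // eq_sym oner_eq0.
Qed.

(** The quotient of the two pairs has first entry 1, so [diag1r] applies; this makes delta well
    defined. *)
Lemma diag_fun (c d d' : F) : (c, d) \in diag -> (c, d') \in diag -> d = d'.
Proof.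
move=> cd cd'; have [c0 d0 _] := diagP _ _ cd.
have := diagM (diagV cd) cd'; rewrite starVl // => /diag1r E.
by apply: (starIl (sinv_neq0 d0)); rewrite /= E starVl.
Qed.

(** * The groups C and D and the map delta *)

Definition Cset : {set F} := [set w.1 | w in diag].
Definition Dset : {set F} := [set w.2 | w in diag].

(** The default 1 is taken only outside [Cset]. *)
Definition delta (c : F) : F := odflt 1 [pick d | (c, d) \in diag].

Lemma deltaP (c d : F) : c \in Cset -> ((c, d) \in diag) = (delta c == d).
Proof.
case/imsetP=> -[c' d'] cd' /= cE; rewrite -{c'}cE in cd'; rewrite /delta.
case: pickP => [d'' cd''|/(_ d')]; last by rewrite cd'.
by apply/idP/eqP => [/(diag_fun cd'')|<-].
Qed.

Lemma mem_Cset (c d : F) : (c, d) \in diag -> c \in Cset.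
Proof. exact: imset_f. Qed.

Lemma mem_Dset (c d : F) : (c, d) \in diag -> d \in Dset.
Proof. exact: (@imset_f _ _ (fun w : F * F => w.2)). Qed.

Lemma delta_diag (c : F) : c \in Cset -> (c, delta c) \in diag.
Proof. by move=> cC; rewrite deltaP. Qed.

Lemma delta_eq (c d : F) : (c, d) \in diag -> delta c = d.
Proof. by move=> cd; apply/eqP; rewrite -deltaP ?(mem_Cset cd). Qed.

Lemma card_Cset : #|Cset| = #|diag|.
Proof.
apply: card_in_imset => -[c d] [c' d'] cd cd' /= cE; rewrite -cE in cd' *.
by rewrite (diag_fun cd cd').
Qed.

Lemma Cset0 : Cset \subset [set~ 0].
Proof. by apply/subsetP => _ /imsetP[[c d] /diagP[c0 _ _] ->]; rewrite !inE. Qed.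

Lemma Dset0 : Dset \subset [set~ 0].
Proof. by apply/subsetP => _ /imsetP[[c d] /diagP[_ d0 _] ->]; rewrite !inE. Qed.

Lemma Cset1 : 1 \in Cset. Proof. exact: mem_Cset diag1. Qed.
Lemma Dset1 : 1 \in Dset. Proof. exact: mem_Dset diag1. Qed.

Lemma CsetM : {in Cset &, forall x y, x ⋆ y \in Cset}.
Proof.
move=> _ _ /imsetP[[c d] cd ->] /imsetP[[c' d'] cd' ->].
exact: mem_Cset (diagM cd cd').
Qed.

Lemma DsetM : {in Dset &, forall x y, x ⋆ y \in Dset}.
Proof.
move=> _ _ /imsetP[[c d] cd ->] /imsetP[[c' d'] cd' ->].
exact: mem_Dset (diagM cd cd').
Qed.

Lemma DsetV (d : F) : d \in Dset -> sinv d \in Dset.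
Proof. by case/imsetP=> -[c d'] cd ->; apply: mem_Dset (diagV cd). Qed.

Lemma CsetV (c : F) : c \in Cset -> sinv c \in Cset.
Proof. by case/imsetP=> -[c' d] cd ->; apply: mem_Cset (diagV cd). Qed.

Lemma card_Cset_dvd : (#|Cset| %| q ^ 2 - 1)%N.
Proof.
rewrite subn1 -card_setC0; apply: card_dvd_star_free; rewrite ?Cset0 ?Cset1 //.
  exact: CsetM.
move=> s c s0 cC; apply: star_closed_setC0 => //; exact: (subsetP Cset0).
Qed.

Lemma card_WD0 : #|W :\ 0| = q.-1.
Proof. by rewrite -card_W (cardsD1 0 W) Wset0. Qed.

Lemma WD0_sub : W :\ 0 \subset [set~ 0].
Proof. by apply/subsetP => x; rewrite !inE => /andP[]. Qed.

(** D acts freely on the q - 1 nonzero elements of [W], so the (q - 1)-st nearfield power of d is 1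
    and [is_square_rmulX] applies. Consequently the nearfield and field products agree on D. *)
Lemma Dset_square (d : F) : d \in Dset -> is_square d.
Proof.
move=> dD; have d0 := neq0_closed Dset0 dD; apply: is_square_rmulX => //.
have /dvdnP[k ->] : (#|Dset| %| q.-1)%N.
  rewrite -card_WD0; apply: card_dvd_star_free; rewrite ?Dset0 ?Dset1 ?WD0_sub //.
    exact: DsetM.
  move=> s _ /setD1P[s0 sW] /imsetP[[c d'] cd ->]; have [_ d0' _] := diagP _ _ cd.
  by apply/setD1P; split; [apply: star_neq0 | apply: diag_W cd sW].
rewrite mulnC expgM (rmulX_card Dset0 Dset1) ?expg1n //; exact: DsetM.
Qed.

(** * The scalar field of W *)

Definition Kset : {set F} := [set k | [forall w in W, k * w \in W]].

Lemma KsetP (k : F) : reflect {in W, forall w, k * w \in W} (k \in Kset).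
Proof. rewrite [_ \in Kset]inE; exact: forall_inP. Qed.

(** Division is possible because multiplication by a nonzero y in [Kset] maps the finite set [W]
    injectively into itself, hence onto. *)
Lemma Kset_closed : divring_closed Kset.
Proof.
split=> [|x y /KsetP xK /KsetP yK|x y /KsetP xK /KsetP yK].
- by apply/KsetP => w wW; rewrite mul1r.
- by apply/KsetP => w wW; rewrite mulrBl WsetB ?xK ?yK.
(* For y = 0 the quotient is 0, by the convention on the inverse of 0. *)
case: (eqVneq y 0) => [->|y0].
  by apply/KsetP => w wW; rewrite invr0 mulr0 mul0r Wset0.
have /eqP yW : *%R y @: W == W.
  rewrite eqEcard card_imset ?leqnn ?andbT; last exact: mulfI.
  by apply/subsetP => _ /imsetP[w /yK wW ->].
apply/KsetP => w; rewrite -{1}yW => /imsetP[w' w'W ->].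
by rewrite mulrA divfK // xK.
Qed.

Lemma Kset_scalar : scalar_field W Kset.
Proof.
split; first exact: Kset_closed.
  apply/setP => w; apply/imset2P/idP => [[k w' /KsetP kK w'W ->]|wW]; first exact: kK.
  by exists 1 w; rewrite ?mul1r //; apply/KsetP => v vW; rewrite mul1r.
move=> K' _ K'W; apply/subsetP => k kK'; apply/KsetP => w wW.
by rewrite -K'W; apply/imset2P; exists k w.
Qed.

(** For nonzero k, the cyclic group generated by multiplication by k acts freely on the q - 1
    nonzero elements of [W], so k^(q - 1) = 1. *)
Lemma Kset_Fq : Kset \subset Fq F q.
Proof.
apply/subsetP => k /KsetP kK; rewrite inE; case: (eqVneq k 0) => [->|k0].
  by rewrite expr0n (gtn_eqF q_gt0).
pose m : {perm F} := perm (mulfI k0).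
have mX i x : (m ^+ i)%g x = k ^+ i * x.
  elim: i x => [|i IH] x; first by rewrite perm1 mul1r.
  by rewrite expgSr permM IH permE mulrA -exprS.
have : (#[m]%g %| #|W :\ 0%R|)%N.
  apply: card_dvd_free_action => _ s /cycleP[i ->]; rewrite !in_setD1 mX.
    case/andP=> s0 sW; rewrite mulf_neq0 ?expf_neq0 //=.
    by elim: i => [|i IH]; rewrite ?mul1r // exprS -mulrA kK.
  move=> /andP[s0 _] /eqP; rewrite -[X in _ == X]mul1r (inj_eq (mulIf s0)) => /eqP E.
  by apply/permP => x; rewrite mX E mul1r perm1.
rewrite card_WD0 order_dvdn => /eqP/permP/(_ 1); rewrite mX mulr1 perm1 => E.
by rewrite -[q]prednK ?q_gt0 // exprS E mulr1.
Qed.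

(** Elements of D are squares, so their nearfield action on [W] is multiplication by a scalar. *)
Lemma Dset_K : Dset \subset Kset :\ 0.
Proof.
apply/subsetP => d dD; rewrite in_setD1 (neq0_closed Dset0 dD) /=.
apply/KsetP => w wW; rewrite mulrC -star_sq ?Dset_square //.
by case/imsetP: dD => -[c d'] cd ->; apply: diag_W cd wW.
Qed.

Lemma Dset_divr_closed : divr_closed Dset.
Proof.
split=> [|x y xD yD]; first exact: Dset1.
have yE : y^-1 = sinv y by rewrite /sinv Dset_square.
by rewrite yE -star_sq ?Dset_square ?DsetV // DsetM ?DsetV.
Qed.

Lemma delta_img : [set delta c | c in Cset] = Dset.
Proof.
apply/setP => d; apply/imsetP/imsetP => [[c cC ->]|[[c d'] cd ->]].
  by exists (c, delta c) => //; apply: delta_diag.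
by exists c; rewrite ?(mem_Cset cd) // (delta_eq cd).
Qed.

Lemma deltaM : {in Cset &, forall c c', delta (c ⋆ c') = delta c * delta c'}.
Proof.
move=> c c' cC cC'; have cG := delta_diag cC'.
by rewrite -star_sq ?Dset_square ?(mem_Dset cG) //; apply/delta_eq/diagM; apply: delta_diag.
Qed.

Definition delta_ker : {set F} := [set c in Cset | delta c == 1].

(** Right multiplication by a preimage of d carries the kernel onto the fibre. *)
Lemma card_fiber (d : F) : d \in Dset -> #|[set c in Cset | delta c == d]| = #|delta_ker|.
Proof.
case/imsetP=> -[c0 d'] cd ->{d} /=; have [c00 d0 _] := diagP _ _ cd.
rewrite -[RHS](card_imset _ (starIr c00)); apply: eq_card => c.
rewrite inE; apply/andP/imsetP => [[cC]|[b]].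
  rewrite -deltaP // => cd'; exists (c ⋆ sinv c0); last by rewrite starVKr.
  have := diagM cd' (diagV cd); rewrite starVr // => cG.
  by rewrite inE (mem_Cset cG) (delta_eq cG) eqxx.
rewrite inE => /andP[bC]; rewrite -deltaP // => /diagM/(_ cd) bG ->.
by move: bG; rewrite star1l => bG; rewrite (mem_Cset bG) (delta_eq bG) eqxx.
Qed.

Lemma card_delta_ker : #|delta_ker| = (#|Cset| %/ #|Dset|)%N.
Proof.
have D_gt0 : (0 < #|Dset|)%N by apply/card_gt0P; exists 1; apply: Dset1.
suff -> : #|Cset| = (#|delta_ker| * #|Dset|)%N by rewrite mulnK.
rewrite -[LHS]sum1_card (partition_big delta (mem Dset)) /=; last first.
  by move=> c cC; rewrite -delta_img imset_f.
rewrite (eq_bigr (fun _ => #|delta_ker|)) ?sum_nat_const 1?mulnC // => d dD.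
by rewrite -(card_fiber dD) -sum1_card; apply: eq_bigl => c; rewrite inE.
Qed.

(* The kernel of [delta] acts freely on the affine points of [U] on a horizontal
   secant. *)
Lemma card_delta_ker_dvd : (#|delta_ker| %| q.+1)%N.
Proof.
have [b bW] : exists b, b \notin W.
  apply/existsP; rewrite -negb_forall; apply/negP => /forallP WT.
  have : (#|F| <= #|W|)%N by apply/subset_leq_card/subsetP => b _; apply: WT.
  rewrite card_W cardF -{2}[q]expn1 leq_exp2l ?ltnNge //.
  by rewrite -ltnNge (leq_trans _ q_gt2).
(* For b outside [W] the line y = b is a secant, and its point at infinity is not in [U], so all q +
   1 common points are affine. *)
have bT : tangent q U (pline (Some 0) b) = false.
  by apply/negP => bT; case/negP: bW; rewrite -tangent_idx_horizontal inE.
have := card_aline_tangent (Some 0) b uU.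
rewrite bT pdir_in_U //= mul0n addn0 => bq; rewrite -bq.
pose S := [set x | (x, b) \in aset U].
have -> : #|aline U (Some 0) b| = #|S|.
  rewrite -[RHS](card_imset _ (fun x x' (E : (x, b) = (x', b)) => congr1 fst E)).
  apply: eq_card => -[x y]; rewrite inE /= star0r subr0.
  apply/andP/imsetP => [[xyA /eqP yb]|[x']].
    by exists x; rewrite ?yb // inE -yb.
  by rewrite inE => xA [-> ->].
apply: card_dvd_star_free.
- by apply/subsetP => c; rewrite inE => /andP[/(subsetP Cset0)].
- by rewrite inE Cset1 (delta_eq diag1) eqxx.
- move=> c c'; rewrite !inE => /andP[cC]; rewrite -deltaP // => cG /andP[cC'].
  rewrite -deltaP // => cG'; have := diagM cG cG'; rewrite star1l => ccG.
  by rewrite (mem_Cset ccG) (delta_eq ccG) eqxx.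
(* The coordinate 0 cannot occur, since (0,b) in [U] would put b in [W]. *)
- apply/subsetP => x; rewrite !inE -asetE; apply: contraTneq => ->.
  by rewrite aset0.
move=> x c; rewrite !inE -!asetE => xA /andP[cC]; rewrite -deltaP //.
case/diagP=> c0 d0 gA; have := aset_lphi x b c0 d0 gA.
by rewrite star1r !addr0 xA.
Qed.

(** * The assertions of the theorem for a unital in normal form *)

Local Notation G := (AutU q U :&: linear_colls F q).
Local Notation H := (AutU q U :&: translations F q).
Local Notation G1 := (G :&: R0hat F q).

Lemma H_eq : H = [set phi q 1 1 0 w | w in W].
Proof.
apply/setP => g; rewrite lphiE; apply/translationAutP/imsetP => [[w wW ->]|[w wW ->]]; by exists w.
Qed.

Lemma Wset_subspace : Fp_subspace p W.
Proof.
split=> [|a u v uW vW]; first exact: Wset0.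
rewrite mulr_natl; elim: {a}(a : nat) => [|n IH]; first by rewrite mulr0n add0r.
by rewrite mulrS -addrA WsetD.
Qed.

Lemma vert_line_U :
  points_on q (vert_line (0 : F)) :&: U = vert_pt F |: [set aff 0 w | w in W].
Proof.
have -> : vert_line (0 : F) = pline None 0 by rewrite /= oppr0.
apply/setP => P; rewrite in_setI in_setU1 [P \in points_on _ _]inE.
case: (pointP P) => [x y|o].
  rewrite incident_aff /=; have /eqP/negPf-> := @aff_neq_dir x y None.
  apply/andP/imsetP => [[/eqP -> yU]|[w wW /aff_inj[-> ->]]].
    by exists y; rewrite -?aset0 ?asetE.
  by rewrite eqxx -asetE aset0.
rewrite incident_dir (pdir_in_U uU vU qtvec) andbb (inj_eq pdir_inj _ None).
case: (o == None) => //=; apply/esym/imsetP => -[w _ /esym].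
exact: aff_neq_dir.
Qed.

Local Notation affine_tangents :=
  [set l : line F | [&& l != inf_line F, incident q (slope_pt 0) l & tangent q U l]].

Lemma affine_tangentsE : affine_tangents = [set pline (Some 0) w | w in W].
Proof.
apply/setP => l; rewrite [l \in affine_tangents]inE.
apply/and3P/imsetP => [[]|[w wW ->]]; last first.
  split; first exact: pline_neq_inf.
    by rewrite (incident_dir _ _ (Some 0)).
  by move: wW; rewrite -tangent_idx_horizontal inE.
case: (lineP l) => [o t _|]; last by rewrite eqxx.
rewrite (incident_dir _ _ (Some 0)) => /eqP<- tT.
by exists t; rewrite // -tangent_idx_horizontal inE.
Qed.

Lemma card_affine_tangents : #|affine_tangents| = q.
Proof. by rewrite affine_tangentsE card_imset ?card_W //; apply: pline_inj. Qed.

Lemma tangency_points :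
  [set aff 0 w | w in W] = \bigcup_(l in affine_tangents) (points_on q l :&: U).
Proof.
rewrite affine_tangentsE; apply/setP => P; apply/imsetP/bigcupP.
  case=> w wW ->; exists (pline (Some 0) w); first exact: imset_f.
  rewrite in_setI [_ \in points_on _ _]inE incident_aff /= star0l subr0 eqxx.
  by rewrite -asetE aset0.
case=> _ /imsetP[w wW ->]; rewrite in_setI [P \in points_on _ _]inE.
case: (pointP P) => [x y|o].
  rewrite incident_aff -asetE /= star0r subr0 => /andP[/eqP-> xw].
  by exists w; rewrite // (aset_W xw).
by rewrite incident_dir (pdir_in_U uU vU qtvec) => /andP[/eqP->].
Qed.

Lemma G_group_set : group_set G.
Proof. exact: (groupP (AutU q U :&: group linear_group_set)%G). Qed.

Lemma H_group_set : group_set H.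
Proof. exact: (groupP (AutU q U :&: group translation_group_set)%G). Qed.

Lemma G_factor : G = (H * G1)%g.
Proof.
apply/setP => g; apply/linearAutP/mulsgP => [[c [d [v [cd vW ->]]]]|[h k]].
  have [c0 d0 gA] := diagP _ _ cd; have [dc0 dd0] := (sinv_neq0 c0, sinv_neq0 d0).
  have vdW : v ⋆ sinv d \in W := diag_W (diagV cd) vW.
  (* The translation acts first and its vector is then multiplied by d, whence the factor
     [sinv d]. *)
  exists (lphi 1%R 1%R 0 (v ⋆ sinv d)) (lphi c d 0 0).
  - by apply/translationAutP; exists (v ⋆ sinv d).
  - by apply/diagAutP; exists c, d.
  - by rewrite lphiM ?oner_neq0 // !star1l star0l !addr0 starVKr.
move=> /translationAutP[w wW ->] /diagAutP[c [d [cd ->]]] ->; have [c0 d0 gA] := diagP _ _ cd.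
exists c, d, (w ⋆ d); split=> //; first exact: diag_W cd wW.
by rewrite lphiM ?oner_neq0 // !star1l star0l !addr0.
Qed.

Lemma q_dvd_G : (q %| #|G|)%N.
Proof. by rewrite card_G dvdn_mulr. Qed.

Lemma card_G_dvd : (#|G| %| q * (q ^ 2 - 1))%N.
Proof. by rewrite card_G dvdn_pmul2l ?q_gt0 // -card_Cset card_Cset_dvd. Qed.

Lemma card_G1_div : #|G1| = (#|G| %/ q)%N.
Proof. by rewrite card_G1 card_G mulKn ?q_gt0. Qed.

Lemma H_normal : (H <| G)%g.
Proof.
apply/andP; split.
  apply/subsetP => _ /translationAutP[w wW ->]; apply/linearAutP; exists 1, 1, w; split=> //.
  exact: diag1.
apply/subsetP => g /linearAutP[c [d [v [cd vW ->]]]]; have [c0 d0 _] := diagP _ _ cd.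
rewrite inE; apply/subsetP => _ /imsetP[_ /translationAutP[w wW ->] ->].
apply/translationAutP; exists (w ⋆ d); first exact: diag_W cd wW.
(* Moving the inverse to the other side leaves an equation between products of [lphi], settled by
   the composition rule. *)
rewrite conjgE; apply: (canLR (mulKg _)).
rewrite !lphiM ?oner_neq0 // !star1l !star1r star0l !add0r.
by rewrite addrC.
Qed.

Lemma CsetE : [set c : F | (c != 0) &&
  [exists d : F, (d != 0) && (phi q c d 0 0 \in G1)]] = Cset.
Proof.
apply/setP => c; rewrite [LHS]inE lphiE; apply/andP/idP => [[c0 /existsP[d /andP[d0]]]|cC].
  by rewrite phi_in_G1 //; apply: mem_Cset.
have cd := delta_diag cC; have [c0 d0 _] := diagP _ _ cd; split=> //.
by apply/existsP; exists (delta c); rewrite d0 phi_in_G1.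
Qed.

Lemma DsetE : [set d : F | (d != 0) &&
  [exists c : F, (c != 0) && (phi q c d 0 0 \in G1)]] = Dset.
Proof.
apply/setP => d; rewrite [LHS]inE lphiE; apply/andP/imsetP => [[d0 /existsP[c /andP[c0]]]|].
  by rewrite phi_in_G1 // => cd; exists (c, d).
case=> -[c d'] cd ->; have [c0 d0 _] := diagP _ _ cd; split=> //.
by apply/existsP; exists c; rewrite c0 phi_in_G1.
Qed.

Lemma Cset_star_subgroup : star_subgroup q Cset.
Proof.
split; [exact: Cset0 | exact: Cset1 | exact: CsetM |] => c cC.
have c0 := neq0_closed Cset0 cC.
by exists (sinv c); rewrite ?CsetV ?starVl ?starVr.
Qed.

Lemma delta_G1 (c d : F) : c \in Cset -> d != 0 ->
  (phi q c d 0 0 \in G1) = (delta c == d).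
Proof.
by move=> cC d0; rewrite lphiE phi_in_G1 ?(neq0_closed Cset0 cC) ?deltaP.
Qed.

End NormalForm.

(** * Reduction to the normal form *)

Lemma unital_coll (U : {set point F}) (g : {perm point F}) :
  g \in Coll F q -> unital q U -> unital q (g @: U).
Proof.
move=> gC [cU lU]; split; first by rewrite card_imset //; apply: perm_inj.
move=> l; have /CollP/(_ l)[l' gl] : (g^-1)%g \in Coll F q by rewrite groupV.
have := lU l'; rewrite /tangent /secant -(@card_coll_line U g l' l) // => P.
by rewrite -gl permK.
Qed.

(** The commutation hypothesis says that k is the conjugate of h by g, in a form that requires no
    computation of inverses. *)
Lemma AutU_conj (U : {set point F}) (g h k : {perm point F}) :
  h \in Coll F q -> k \in Coll F q -> (h * g = g * k)%g ->
  (k \in AutU q (g @: U)) = (h \in AutU q U).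
Proof.
move=> hC kC hg; have gI := @perm_inj _ g.
have kg P : k (g P) = g (h P) by rewrite -!permM hg.
apply/AutUP/AutUP => -[_ S]; split=> // P.
  by have := S (g P); rewrite kg !(mem_imset _ _ gI).
by rewrite -[P](permKV g) kg !(mem_imset _ _ gI).
Qed.

Lemma card_tvec_swap (U : {set point F}) : #|tvec (swap @: U)| = #|tvec U|.
Proof.
have one0 := oner_neq0 F.
have fI : injective (fun w : F * F => (w.2, w.1)) by move=> [u v] [u' v'] [-> ->].
rewrite -[RHS](card_imset _ fI); apply: eq_card => -[u v].
have -> : ((u, v) \in tvec (swap @: U)) = ((v, u) \in tvec U).
  rewrite !mem_tvec; apply: AutU_conj; try by have [] := lphi_spec u v one0 one0.
    by have [] := lphi_spec v u one0 one0.
  exact: lphi_swap.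
by rewrite -(mem_imset _ _ fI).
Qed.

Lemma tvec_translate (U : {set point F}) (a b : F) : tvec (lphi 1 1 a b @: U) = tvec U.
Proof.
have one0 := oner_neq0 F.
apply/setP => -[u v]; rewrite !mem_tvec.
apply: AutU_conj; try by have [] := lphi_spec u v one0 one0.
by rewrite !lphiM // !star1r addrC [b + v]addrC.
Qed.

Lemma isomorphic_trans (U V V' : {set point F}) :
  isomorphic q U V -> isomorphic q V V' -> isomorphic q U V'.
Proof.
move=> [g gC <-] [h hC <-]; exists (g * h)%g; first exact: groupM.
by rewrite -imset_comp; apply: eq_imset => P; rewrite permM.
Qed.

Lemma normal_form_exists (U' : {set point F}) : unital q U' ->
  vert_pt F \in U' \/ slope_pt (0 : F) \in U' ->
  (q %| #|AutU q U' :&: linear_colls F q|)%N ->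
  exists2 U, isomorphic q U' U & [/\ unital q U, vert_pt F \in U, (q %| #|tvec U|)%N,
    aff 0 0 \in U & 0 \in tangent_idx U (Some 0)].
Proof.
move=> uU' infU' /q_dvd_translations; rewrite -card_tvec => qtvec'.
have [V [isoV uV vV qtvecV]] : exists V, [/\ isomorphic q U' V, unital q V,
    vert_pt F \in V & (q %| #|tvec V|)%N].
  case: infU' => [vU'|sU'].
    exists U'; split=> //; exists 1%g; first exact: group1.
    by apply/setP => P; apply/imsetP/idP => [[Q QU ->]|PU];
      [rewrite perm1 | exists P; rewrite ?perm1].
  (* The swap takes (1,0,0) to (0,1,0) and preserves the number of translations. *)
  have [sC _ sD] := swap_spec; exists (swap @: U'); split.
  - by exists swap.
  - exact: unital_coll.
  - by apply/imsetP; exists (pdir (Some 0)); rewrite // sD /= eqxx.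
  - by rewrite card_tvec_swap.
(* One of the q horizontal tangents is chosen, and its point of contact (x,y) is then translated to
   the origin. *)
have /card_gt0P[t tT] : (0 < #|tangent_idx V (Some 0%R)|)%N.
  by rewrite card_tangent_idx_Some ?q_gt0.
have [[x y] xyE] := tangent_idxE uV vV qtvecV tT.
have : (x, y) \in aline V (Some 0) t by rewrite xyE in_set1.
rewrite inE asetE /= star0r subr0 => /andP[xyV /eqP yt].
have one0 := oner_neq0 F.
have [gC gA gD] := lphi_spec (- x) (- y) one0 one0.
exists (lphi 1 1 (- x) (- y) @: V).
  by apply: (isomorphic_trans isoV); exists (lphi 1 1 (- x) (- y)).
split.
- exact: unital_coll.
- by apply/imsetP; exists (pdir None); rewrite // gD.
- by rewrite tvec_translate.
- by apply/imsetP; exists (aff x y); rewrite // gA !star1r !subrr.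
have := card_coll_line V (incident_translate (- x) (- y) (Some 0) t).
rewrite /= star0r subr0 yt subrr inE /tangent => ->.
by move: tT; rewrite inE.
Qed.

End Nearfield.

Theorem theorem5p2 (p e q : nat) (F : finFieldType)
    (p_prime : prime p) (p_odd : odd p) (e_gt0 : (0 < e)%N)
    (qE : q = (p ^ e)%N) (cardF : #|F| = (q ^ 2)%N)
    (U' : {set point F}) (U'_unital : unital q U')
    (U'_inf : vert_pt F \in U' \/ slope_pt (0 : F) \in U')
    (U'_div : (q %| #|AutU q U' :&: linear_colls F q|)%N) :
  exists2 U : {set point F}, isomorphic q U' U &
  exists W K : {set F},
  let H := AutU q U :&: translations F q in
  let G := AutU q U :&: linear_colls F q in
  let G1 := G :&: R0hat F q in
  let C := [set c : F | (c != 0) && [exists d : F, (d != 0) && (phi q c d 0 0 \in G1)]] in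
  let D := [set d : F | (d != 0) && [exists c : F, (c != 0) && (phi q c d 0 0 \in G1)]] in
  let affine_tangents :=
    [set l : line F | [&& l != inf_line F, incident q (slope_pt 0) l & tangent q U l]] in
  let r := (#|C| %/ #|D|)%N in
  (* (i) *)
  (unital q U /\ parabolic q U /\ vert_pt F \in U) /\
  (* (ii) *)
  (H = [set phi q 1 1 0 w | w in W] /\ Fp_subspace p W /\ #|W| = q /\
   scalar_field W K /\ K \subset Fq F q) /\
  (* (iii) *)
  (points_on q (vert_line 0) :&: U = vert_pt F |: [set aff 0 w | w in W] /\
   #|affine_tangents| = q /\
   [set aff 0 w | w in W] = \bigcup_(l in affine_tangents) (points_on q l :&: U)) /\
  (* (iv) *)
  (G = (H * G1)%g /\ (q %| #|G|)%N /\ (#|G| %| q * (q ^ 2 - 1))%N) /\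
  (* (v) *)
  (group_set G /\ group_set H /\ (H <| G)%g) /\
  (* (vi) *)
  #|G1| = (#|G| %/ q)%N /\
  (* (vii) *)
  (#|C| = #|G1| /\ star_subgroup q C) /\
  (* (viii) *)
  (D \subset K :\ 0 /\ divr_closed D /\ D \subset Fq F q :\ 0) /\
  (* (ix) *)
  (exists delta : F -> F,
     (forall c d : F, c \in C -> d != 0 -> (phi q c d 0 0 \in G1) = (delta c == d)) /\
     [set delta c | c in C] = D /\
     {in C &, forall c c', delta (star q c c') = delta c * delta c'} /\
     {in D, forall d, #|[set c in C | delta c == d]| = r} /\
     (r %| q.+1)%N).
Proof.
have [U isoU [uU vU qtvec U0 T0]] :=
  normal_form_exists p_prime p_odd e_gt0 qE cardF U'_unital U'_inf U'_div.
exists U => //; exists (Wset q U), (Kset q U) => H G G1 C D affine_tangents r.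
have CE : C = Cset q U := CsetE p_prime p_odd e_gt0 qE cardF uU vU qtvec U0 T0.
have DE : D = Dset q U := DsetE p_prime p_odd e_gt0 qE cardF uU vU qtvec U0 T0.
have rE : #|delta_ker q U| = r.
  by rewrite /r CE DE (card_delta_ker p_prime p_odd e_gt0 qE cardF).
have DK := Dset_K p_prime p_odd e_gt0 qE cardF uU vU qtvec U0.
have KFq : Kset q U \subset Fq F q by apply: (Kset_Fq p_prime p_odd e_gt0 qE cardF).
(* With r replaced by the size of the kernel of delta, the r-to-1 property becomes the count of a
   fibre. *)
rewrite CE DE -rE; split; last split; last split; last split; last split;
  last split; last split; last split.
- by split=> //; split=> //; apply: (parabolic_of_tvec p_prime p_odd e_gt0 qE cardF).
- split; first exact: (H_eq p_prime p_odd e_gt0 qE cardF).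
  split; first exact: (Wset_subspace p_prime p_odd e_gt0 qE cardF).
  split; first exact: (card_Wset p_prime p_odd e_gt0 qE cardF).
  by split=> //; apply: (Kset_scalar p_prime p_odd e_gt0 qE cardF).
- split; first exact: (vert_line_U p_prime p_odd e_gt0 qE cardF).
  split; first exact: (card_affine_tangents p_prime p_odd e_gt0 qE cardF).
  exact: (tangency_points p_prime p_odd e_gt0 qE cardF).
- split; first exact: (G_factor p_prime p_odd e_gt0 qE cardF).
  split; first exact: (q_dvd_G p_prime p_odd e_gt0 qE cardF).
  exact: (card_G_dvd p_prime p_odd e_gt0 qE cardF).
- split; first exact: (G_group_set p_prime p_odd e_gt0 qE cardF).
  split; first exact: (H_group_set p_prime p_odd e_gt0 qE cardF).
  exact: (H_normal p_prime p_odd e_gt0 qE cardF).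
- exact: (card_G1_div p_prime p_odd e_gt0 qE cardF).
- split; last exact: (Cset_star_subgroup p_prime p_odd e_gt0 qE cardF).
  by rewrite (card_Cset p_prime p_odd e_gt0 qE cardF) // -(card_G1 p_prime p_odd e_gt0 qE cardF).
- split; first exact: DK.
  split; first exact: (Dset_divr_closed p_prime p_odd e_gt0 qE cardF).
  exact: subset_trans DK (setSD _ KFq).
exists (delta q U); split; last split; last split; last split.
- exact: (delta_G1 p_prime p_odd e_gt0 qE cardF).
- exact: (delta_img p_prime p_odd e_gt0 qE cardF).
- exact: (deltaM p_prime p_odd e_gt0 qE cardF).
- by move=> d dD; apply: (card_fiber p_prime p_odd e_gt0 qE cardF).
- exact: (card_delta_ker_dvd p_prime p_odd e_gt0 qE cardF).
Qed.
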